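(* Let $K$ be a CM field of degree $2g$ with maximal totally real subfield $K_0$, and suppose $\mathcal{D}_{K_0/\mathbf{Q}}$ is principal, generated by $\delta$. Let $\mathfrak{b}$ be a fractional $\mathcal{O}_{K_0}$-ideal with $\mathbf{Z}$-basis $b_1,\dots,b_g$, and let $b_1^*,\dots,b_g^*\in K_0$ be the dual basis with respect to the trace form $T(a,b)=\mathrm{Tr}_{K_0/\mathbf{Q}}(ab)$. Suppose $z\in K$ is such that $\mathfrak{a}=z\mathfrak{b}+\mathfrak{b}^{-1}$ is an $\mathcal{O}_K$-submodule of $K$. Let $\xi=(z-\overline z)^{-1}\delta^{-1}$ and $\Phi=\{\phi:K\to\mathbf{C}\mid\mathrm{Im}\,\phi(\xi)>0\}$. Then $\Phi$ is a CM type, $\mathfrak{a}$ is a fractional $\mathcal{O}_K$-ideal, $\xi$ generates $(\mathfrak{a}\overline{\mathfrak{a}}\mathcal{D}_{K/\mathbf{Q}})^{-1}$ and $\phi(\xi)$ lies on the positive imaginary axis for every $\phi\in\Phi$; moreover the basis $\Phi(zb_1),\dots,\Phi(zb_g),\Phi(\delta b_1^* ),\dots,\Phi(\delta b_g^* )$ of $\Phi(\mathfrak{a})$ is symplectic with respect to $E_\xi$.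
   Context: A CM field of degree $2g$ is a totally imaginary quadratic extension of a totally real field $K_0$ of degree $g$. A CM type is a set $\Phi$ of $g$ embeddings $K\to\mathbf{C}$ with $\Phi\cup\overline\Phi$ all $2g$ embeddings; $\Phi(\alpha)=(\phi(\alpha))_{\phi\in\Phi}\in\mathbf{C}^g$. $E_\xi:\mathbf{C}^g\times\mathbf{C}^g\to\mathbf{R}$ is the $\mathbf{R}$-bilinear extension of $E_\xi(\Phi(\alpha),\Phi(\beta))=\mathrm{Tr}_{K/\mathbf{Q}}(\xi\alpha\overline\beta)$. A basis $e_1,\dots,e_g,v_1,\dots,v_g$ of a lattice is symplectic for $E$ if $E(e_i,v_j)=\delta_{ij}$ and $E(e_i,e_j)=E(v_i,v_j)=0$. *)

(* Defs.v *)
From HB Require Import structures.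
From mathcomp Require Import all_boot all_order all_algebra all_field.
From mathcomp Require Import all_classical reals complex.

Set Implicit Arguments.
Unset Strict Implicit.
Unset Printing Implicit Defensive.

Import Order.TTheory GRing.Theory Num.Theory.

Local Open Scope ring_scope.
Local Open Scope classical_set_scope.
Local Open Scope complex_scope.

(* A number field is a [fieldExtType rat]. A subfield [K0 : {subfield K}] is
   itself a number field through the type [subvs_of K0], with inclusion
   [vsval : subvs_of K0 -> K]. *)

Section NumberField.
Variable L : fieldExtType rat.
Implicit Types I J : set L.

Definition ring_of_integers : set L :=
  [set x | integralOver (intr : int -> L) x].

(* Tr_{L/Q}(x): the trace of the Q-linear endomorphism "multiplication by x",
   computed in the Q-basis [vbasis {:L}]. *)
Definition field_trace (x : L) : rat :=
  \tr (passmx.mxof (vbasis {:L}) (vbasis {:L}) (amull x)).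

Definition is_integer_submodule I : Prop :=
  [/\ I 0,
      forall x y, I x -> I y -> I (x + y)
    & forall a x, ring_of_integers a -> I x -> I (a * x)].

Definition is_fractional_ideal I : Prop :=
  [/\ is_integer_submodule I,
      exists2 x, I x & x != 0
    & exists2 d, ring_of_integers d /\ d != 0 &
        forall x, I x -> ring_of_integers (d * x)].

Definition principal_ideal (d : L) : set L :=
  [set d * x | x in ring_of_integers].

Definition ideal_mul I J : set L :=
  [set x | exists n (u v : 'I_n -> L),
     (forall i, I (u i) /\ J (v i)) /\ x = \sum_i u i * v i].

Definition ideal_inv I : set L :=
  [set x | forall y, I y -> ring_of_integers (x * y)].

Definition codifferent : set L :=
  [set x | forall y, ring_of_integers y -> field_trace (x * y) \is a Num.int].

Definition different : set L := ideal_inv codifferent.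

Definition is_dual_basis (g : nat) (b bs : 'I_g -> L) : Prop :=
  forall i j, field_trace (b i * bs j) = (i == j)%:R.

End NumberField.

Arguments ring_of_integers : clear implicits.
Arguments codifferent : clear implicits.
Arguments different : clear implicits.

Definition is_Zbasis (V : zmodType) (I : finType) (M : set V) (e : I -> V) :
    Prop :=
  M = [set \sum_i e i *~ n i | n in [set: I -> int]] /\
  forall n : I -> int, \sum_i e i *~ n i = 0 -> forall i, n i = 0.

Definition is_symplectic_basis (R : realType) (V : Type) (g : nat)
    (E : V -> V -> R) (e v : 'I_g -> V) : Prop :=
  [/\ forall i j, E (e i) (v j) = (i == j)%:R,
      forall i j, E (e i) (e j) = 0
    & forall i j, E (v i) (v j) = 0].

Section CM.
Variable R : realType.

Definition totally_real (L : fieldExtType rat) : Prop :=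
  forall (phi : {rmorphism L -> R[i]}) x, complex.Im (phi x) = 0.

Definition totally_imaginary (L : fieldExtType rat) : Prop :=
  forall phi : {rmorphism L -> R[i]}, exists x, complex.Im (phi x) != 0.

Variable K : fieldExtType rat.

Definition is_CM_field : Prop :=
  totally_imaginary K /\
  exists2 F : {subfield K}, totally_real (subvs_of F) & \dim_F {:K} = 2%N.

Definition is_maximal_totally_real (F : {subfield K}) : Prop :=
  totally_real (subvs_of F) /\
  forall F' : {subfield K},
    totally_real (subvs_of F') -> (F <= F')%VS -> (F' <= F)%VS.

(* Complex conjugation of a CM field K: the element of K mapped to the complex
   conjugate of phi(x) by every embedding phi (junk value 0 if there is none,
   which does not happen for CM fields). *)
Definition cm_conj (x : K) : K :=
  xget 0 [set y | forall phi : {rmorphism K -> R[i]}, phi y = (phi x)^*].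

Definition conj_embedding (phi : {rmorphism K -> R[i]}) :
    {rmorphism K -> R[i]} := conjc \o phi.

Definition is_CM_type (g : nat) (Phi : set {rmorphism K -> R[i]}) : Prop :=
  (Phi #= `I_g)%card /\
  Phi `|` conj_embedding @` Phi = [set: {rmorphism K -> R[i]}].

(* Phi(alpha) in C^g, the elements of the CM type being listed as phi_1, ...,
   phi_g. *)
Definition CM_vec (g : nat) (phi : 'I_g -> {rmorphism K -> R[i]}) (x : K) :
    'rV[R[i]]_g := \row_i phi i x.

Definition is_real_bilinear (g : nat) (E : 'rV[R[i]]_g -> 'rV[R[i]]_g -> R) :
    Prop :=
  (forall (r : R) u v w, E (r%:C *: u + v) w = r * E u w + E v w) /\
  (forall (r : R) u v w, E w (r%:C *: u + v) = r * E w u + E w v).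

(* E is the form E_xi: the R-bilinear extension of
   (Phi(alpha), Phi(beta)) |-> Tr_{K/Q}(xi alpha bar(beta)). *)
Definition is_E_form (g : nat) (phi : 'I_g -> {rmorphism K -> R[i]}) (xi : K)
    (E : 'rV[R[i]]_g -> 'rV[R[i]]_g -> R) : Prop :=
  is_real_bilinear E /\
  forall x y : K,
    E (CM_vec phi x) (CM_vec phi y) = ratr (field_trace (xi * x * cm_conj y)).

End CM.

(* Main.v *)
(** Write [s] for complex conjugation of [K]; [K0] is its fixed field, [z] is not
    in [K0], [K = z K0 + K0] and [s xi = - xi]. Since [Tr_K x = Tr_K0 (x + s x)],
      [Tr_K (xi (z u + w) s (z u' + w')) = Tr_K0 (delta^-1 (u w' - w u'))],
    so the basis [z b_i], [delta bs_j] is symplectic, and the lattice [fa] is its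
    own dual for this pairing. Self-duality gives [xi fa (s fa) <= codifferent];
    conversely, if [x fa (s fa) different] is integral then [x fa (s fa)] lies in
    the codifferent, hence [(x / xi) fa <= fa] and [x / xi] is integral. Here
    [ideal_inv different = codifferent] is needed: a finitely generated ideal is
    invertible because, by Dedekind's Prague theorem, the coefficients of [f] and
    [g] generate inverse ideals when [f g] is a primitive integer polynomial. *)

Require Import Defs.
From HB Require Import structures.
From mathcomp Require Import all_boot all_order all_algebra all_field.
From mathcomp Require Import all_classical reals complex.
From mathcomp Require Import ring lra.

Set Implicit Arguments.
Unset Strict Implicit.
Unset Printing Implicit Defensive.

Import Order.TTheory GRing.Theory Num.Theory.

Local Open Scope ring_scope.
Local Open Scope classical_set_scope.
Local Open Scope complex_scope.

(** * Integral coefficients of polynomials *)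

(** As the different of [K0] is generated by [delta], the codifferent is [delta^-1 O] and the trace
    dual of [fb] is [delta^-1 fb^-1]. Hence the [delta bs_j] form a Z-basis of [fb^-1], and
    [Tr (delta^-1 u w)] is a perfect pairing of [fb] with [fb^-1]: this is why [delta] enters both
    [xi] and the basis. The trace is by definition that of a multiplication matrix, which says
    nothing about conjugation or subfields. It is rewritten as a sum over embeddings: into [algC]
    for integrality, and into [R[i]] along the CM type, where the same [g] embeddings compute the
    traces of both [K] and [K0]. Invertibility of [fa] and [fb] is never established, self-duality
    replaces it. Only the codifferents of [K0] and [K] must equal their double inverses; the finite
    generation that this requires comes from the Gram matrix of the trace form. *)

Definition integral_coefs (L : nzRingType) (p : {poly L}) : Prop :=
  forall i, integralOver (intr : int -> L) p`_i.

Lemma integral_rmorphE (L M : fieldType) (f : {rmorphism L -> M}) (x : L) :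
  integralOver (intr : int -> M) (f x) <-> integralOver (intr : int -> L) x.
Proof.
split=> -[p mp rp]; exists p => //.
  rewrite -(fmorph_root f) -map_poly_comp; congr (root _ _): rp.
  by apply: eq_map_poly => a /=; rewrite rmorph_int.
rewrite -(fmorph_root f) -map_poly_comp in rp; congr (root _ _): rp.
by apply: eq_map_poly => a /=; rewrite rmorph_int.
Qed.

Lemma integral_sum (L : fieldType) (I : Type) (r : seq I) (P : pred I)
    (F : I -> L) :
  (forall i, P i -> integralOver (intr : int -> L) (F i)) ->
  integralOver (intr : int -> L) (\sum_(i <- r | P i) F i).
Proof.
move=> hF; elim/big_rec: _ => [|i x Pi hx]; first exact: integral0.
exact: integral_add (hF i Pi) hx.
Qed.

Lemma integral_exp (L : fieldType) (x : L) n :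
  integralOver (intr : int -> L) x -> integralOver (intr : int -> L) (x ^+ n).
Proof.
move=> hx; elim: n => [|n IH]; first by rewrite expr0; exact: integral1.
by rewrite exprS; exact: integral_mul.
Qed.

(** Multiplying [p.[r] = 0] by [a ^+ n.-1], with [a] the leading coefficient and [n] the degree,
    gives a monic equation for [a * r] with integral coefficients. *)
Lemma integral_lead_coef_root (L : fieldType) (p : {poly L}) (r : L) :
  integral_coefs p -> root p r ->
  integralOver (intr : int -> L) (lead_coef p * r).
Proof.
move=> hp rp; have [->|p0] := eqVneq p 0.
  by rewrite lead_coef0 mul0r; exact: integral0.
set a := lead_coef p; pose n := (size p).-1.
have n0 : (0 < n)%N.
  by have := root_size_gt1 p0 rp; rewrite /n; case: (size p) => [|[]].
have sp : size p = n.+1 by rewrite /n prednK // size_poly_gt0.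
pose q : {poly L} := 'X^n + \poly_(i < n) (p`_i * a ^+ (n.-1 - i)).
apply: (@integral_root_monic _ _ _ _ q).
- rewrite monicE /q lead_coefDl ?lead_coefXn // size_polyXn ltnS.
  exact: size_poly.
- have := rp; rewrite !rootE horner_coef sp big_ord_recr /= => /eqP rp0.
  have -> : q.[a * r] = a ^+ n.-1 * (\sum_(i < n) p`_i * r ^+ i + p`_n * r ^+ n).
    rewrite /q hornerD hornerXn (horner_coef_wide _ (size_poly _ _)) mulrDr.
    rewrite addrC mulr_sumr; congr (_ + _).
      apply: eq_bigr => i _; rewrite coef_poly ltn_ord exprMn.
      have -> : a ^+ n.-1 = a ^+ (n.-1 - i) * a ^+ i.
        by rewrite -exprD subnK // -ltnS prednK.
      by ring.
    have -> : p`_n = a by rewrite /a lead_coefE sp.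
    by rewrite exprMn mulrA -exprSr prednK.
  by rewrite rp0 mulr0.
- move=> _ /(nthP 0)[i _ <-]; rewrite /q coefD coefXn coef_poly.
  apply: integral_add; first exact: integral_nat.
  case: ifP => _; last exact: integral0.
  by apply: integral_mul (hp i) _; apply: integral_exp; exact: hp.
Qed.

(** Peel off the leading term of [q]. Its coefficient [a] also leads the product, and [a * r] is
    integral because [r] is a root of the product; so subtracting [a X^m (X - r)] keeps the
    coefficients integral and lowers the degree. *)
Lemma integral_coefs_divX (L : fieldType) (q : {poly L}) (r : L) :
  integral_coefs (q * ('X - r%:P)) -> integral_coefs q.
Proof.
have [n sq] := ubnP (size q); elim: n q sq => // n IH q sq hq.
have [->|q0] := eqVneq q 0; first by move=> i; rewrite coef0; exact: integral0.
set a := lead_coef q.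
have lq : lead_coef (q * ('X - r%:P)) = a.
  by rewrite lead_coefM lead_coefXsubC mulr1.
have ha : integralOver (intr : int -> L) a.
  by rewrite -lq lead_coefE; exact: hq.
have har : integralOver (intr : int -> L) (a * r).
  rewrite -lq; apply: integral_lead_coef_root hq _.
  by rewrite rootM root_XsubC eqxx orbT.
pose m := (size q).-1; pose q1 := q - a *: 'X^m.
have hq1 : integral_coefs q1.
  apply: IH.
    have sm : (size q1 <= m)%N.
      apply/leq_sizeP => j; rewrite leq_eqVlt => /predU1P[<-|mj].
        by rewrite /q1 coefB coefZ coefXn eqxx mulr1 /a lead_coefE subrr.
      rewrite /q1 coefB coefZ coefXn gtn_eqF // mulr0 subr0 nth_default //.
      by rewrite /m in mj; case: (size q) mj.
    rewrite (leq_ltn_trans sm) // /m prednK ?size_poly_gt0 //.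
  move=> i; rewrite /q1 mulrBl coefB; apply: integral_sub; first exact: hq.
  rewrite -scalerAl coefZ mulrBr coefB -exprSr coefXn mulrBr.
  apply: integral_sub; first by apply: integral_mul ha _; exact: integral_nat.
  rewrite coefMC coefXn mulrCA; apply: integral_mul har; exact: integral_nat.
move=> i; have -> : q = q1 + a *: 'X^m by rewrite subrK.
rewrite coefD coefZ coefXn; apply: integral_add (hq1 i) _.
by apply: integral_mul ha _; exact: integral_nat.
Qed.

(* Dedekind's Prague theorem. Splitting off a root [r] of [p = p1 (X - r)], both
   [p1 q] and [(r p1) q = X p1 q - p q] have integral coefficients, and [p1] and
   [r p1] have smaller degree. *)
Theorem integral_coef_prod (C : closedFieldType) (p q : {poly C}) :
  integral_coefs (p * q) ->
  forall i j, integralOver (intr : int -> C) (p`_i * q`_j).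
Proof.
have [n sp] := ubnP (size p); elim: n p sp => // n IH p sp hpq i j.
have [s1|s1] := boolP (size p == 1%N).
  move/size_poly1P: s1 hpq => [c c0 ->] hpq; rewrite coefC.
  have := hpq j; rewrite coefCM; case: (i == 0%N) => // _.
  by rewrite mul0r; exact: integral0.
have [r rp] := closed_rootP p s1.
have [p1 dp] := factor_theorem _ _ rp.
have [p0|p0] := eqVneq p1 0.
  by rewrite dp p0 mul0r coef0 mul0r; exact: integral0.
have sp1 : (size p1 < n)%N.
  by move: sp; rewrite dp size_Mmonic ?monicXsubC // size_XsubC addn2.
have h1 : integral_coefs (p1 * q).
  by apply: (@integral_coefs_divX _ _ r); rewrite mulrAC -dp.
have h2 : integral_coefs ((r *: p1) * q).
  move=> k; have -> : (r *: p1) * q = p1 * q * 'X - p * q.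
    by rewrite dp -!mul_polyC; ring.
  rewrite coefB coefMX; apply: integral_sub (hpq k).
  by case: (k == 0%N); [exact: integral0|exact: h1].
have e2 := IH (r *: p1) (leq_ltn_trans (size_scale_leq _ _) sp1) h2 i j.
rewrite coefZ in e2.
rewrite dp mulrBr coefB coefMX coefMC mulrBl [p1`_i * r]mulrC.
apply: integral_sub e2; case: (i == 0%N); last exact: IH.
by rewrite mul0r; exact: integral0.
Qed.

(** * Embeddings and the trace *)

Section Embeddings.
Variables (C : numClosedFieldType) (L : fieldExtType rat).

Lemma rmorph_scale_rat (f : {rmorphism L -> C}) (c : rat) (x : L) :
  f (c *: x) = ratr c * f x.
Proof.
by rewrite -mulr_algl rmorphM -[f _%:A]/((f \o in_alg L) c) fmorph_eq_rat.
Qed.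

Lemma rmorph_horner_rat (f : {rmorphism L -> C}) (q : {poly rat}) (a : L) :
  f (map_poly (in_alg L) q).[a] = (map_poly (ratr : rat -> C) q).[f a].
Proof.
rewrite -horner_map -map_poly_comp; congr (_.[_]); apply: eq_map_poly => c.
exact: (fmorph_eq_rat (f \o in_alg L)).
Qed.

Lemma exists_generator :
  exists a : L, forall x, exists q : {poly rat}, x = (map_poly (in_alg L) q).[a].
Proof.
exists (separable_generator 1 {:L}) => x; apply/Fadjoin1_polyP.
rewrite -eq_adjoin_separable_generator ?memvf ?sub1v //.
apply/separableP => u _; apply: pcharf0_separable => p.
by rewrite pchar_lalg pchar_num.
Qed.

(** The morphism evaluates at [r] a chosen polynomial expression of [x] in [a]; two expressions of
    [x] differ by a multiple of the minimal polynomial [p], which vanishes at [r]. *)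
Lemma embedding_of_root (a : L) (p : {poly rat}) (r : C) :
  (forall x, exists q : {poly rat}, x = (map_poly (in_alg L) q).[a]) ->
  map_poly (in_alg L) p = minPoly 1 a ->
  root (map_poly (ratr : rat -> C) p) r ->
  exists phi : {rmorphism L -> C}, phi a = r.
Proof.
move=> gen dp rp; have [qx qxE] := choice gen.
pose ev (q : {poly rat}) := (map_poly (ratr : rat -> C) q).[r].
pose f x := ev (qx x).
have evE q1 q2 : (map_poly (in_alg L) q1).[a] = (map_poly (in_alg L) q2).[a] ->
    ev q1 = ev q2.
  move=> e; apply/eqP; rewrite -subr_eq0 /ev -hornerN -hornerD -rmorphN -rmorphD.
  have : p %| q1 - q2.
    rewrite -(dvdp_map (in_alg L)) dp; apply: minPoly_dvdp.
      by apply/polyOver1P; exists (q1 - q2).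
    by rewrite rootE rmorphB hornerD hornerN e subrr.
  rewrite -(dvdp_map (ratr : {rmorphism rat -> C})) => /dvdpP[s es].
  by apply/eqP; have := congr1 (horner^~ r) es; rewrite hornerM (rootP rp) mulr0.
have fB : zmod_morphism f.
  move=> x y; rewrite /f -[RHS]/(ev _ - ev _) /ev -hornerN -hornerD -rmorphB.
  by apply: evE; rewrite -qxE rmorphB hornerD hornerN -!qxE.
have fM : monoid_morphism f.
  split.
    have -> : f 1 = ev 1 by apply: evE; rewrite -qxE rmorph1 hornerC.
    by rewrite /ev rmorph1 hornerC.
  move=> x y; rewrite /f -[RHS]/(ev _ * ev _) /ev -hornerM -rmorphM.
  by apply: evE; rewrite -qxE rmorphM hornerM -!qxE.
pose phi : {rmorphism L -> C} :=
  HB.pack f (GRing.isZmodMorphism.Build _ _ f fB)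
    (GRing.isMonoidMorphism.Build _ _ f fM).
exists phi; have -> : phi a = ev 'X by apply: evE; rewrite -qxE map_polyX hornerX.
by rewrite /ev map_polyX hornerX.
Qed.

(** Embeddings correspond to the roots in [C] of the minimal polynomial of a generator, which are
    simple in characteristic 0. *)
Lemma exists_embeddings :
  exists emb : 'I_(\dim {:L}) -> {rmorphism L -> C},
    (forall i j, emb i =1 emb j -> i = j) /\
    (forall phi : {rmorphism L -> C}, exists i, phi =1 emb i).
Proof.
have [a gen] := exists_generator.
have /polyOver1P[p dp] := minPolyOver 1 a.
have dimL : \dim <<1; a>> = \dim {:L}.
  congr (\dim _); apply/vspaceP => x; rewrite memvf; apply/Fadjoin1_polyP.
  exact: gen.
have sp : size p = (\dim {:L}).+1.
  rewrite -(size_map_poly (in_alg L)) -dp size_minPoly; congr _.+1.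
  by rewrite -dimL dim_Fadjoin dimv1 muln1.
have mp : p \is monic by rewrite -(map_monic (in_alg L)) -dp monic_minPoly.
have [s ds] := closed_field_poly_normal (map_poly (ratr : rat -> C) p).
rewrite lead_coef_map (monicP mp) rmorph1 scale1r in ds.
have ss : size s = \dim {:L}.
  by apply/eqP; rewrite -eqSS -(size_prod_XsubC s id) -ds size_map_poly sp.
have us : uniq s.
  rewrite -separable_prod_XsubC -ds separable_map -(separable_map (in_alg L)).
  rewrite -dp; apply: pcharf0_separable => q.
  by rewrite pchar_lalg pchar_num.
have embP (i : 'I_(\dim {:L})) : exists phi : {rmorphism L -> C}, phi a = s`_i.
  apply: (embedding_of_root gen (esym dp)).
  by rewrite ds root_prod_XsubC mem_nth // ss.
have [emb embE] := choice embP; exists emb; split => [i j eij|phi].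
  apply/val_inj/eqP; rewrite -(nth_uniq 0 _ _ us) ?ss ?ltn_ord //.
  by rewrite -!embE eij.
have : root (map_poly (ratr : rat -> C) p) (phi a).
  by rewrite rootE -rmorph_horner_rat -dp minPolyxx rmorph0.
rewrite ds root_prod_XsubC => /(nthP 0)[k]; rewrite ss => kn ek.
exists (Ordinal kn) => x; have [q ->] := gen x.
by rewrite !rmorph_horner_rat embE /= ek.
Qed.

(* The Vandermonde determinant of the conjugates of a generator. *)
Lemma embeddings_independent n (f : 'I_n -> {rmorphism L -> C}) (c : 'I_n -> C) :
  (forall i j, f i =1 f j -> i = j) ->
  (forall x, \sum_i c i * f i x = 0) -> forall i, c i = 0.
Proof.
move=> f_inj c0 i; have [a gen] := exists_generator.
pose V := Vandermonde n (\row_i f i a).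
have uV : V \in unitmx.
  rewrite unitmxE unitfE det_Vandermonde.
  apply/prodf_neq0 => j _; apply/prodf_neq0 => k jk; rewrite !mxE subr_eq0.
  apply/negP => /eqP ejk; move: jk; rewrite (f_inj k j) ?ltnn // => x.
  by have [q ->] := gen x; rewrite !rmorph_horner_rat ejk.
suff : \col_j c j = 0 by move/colP/(_ i); rewrite !mxE.
rewrite -[LHS](mulKmx uV) [V *m _](_ : _ = 0) ?mulmx0 //.
apply/colP => k; rewrite !mxE -[RHS](c0 (a ^+ k)).
by apply: eq_bigr => j _; rewrite !mxE rmorphXn mulrC.
Qed.

Lemma vbasisE (x : L) : x = \sum_i coord (vbasis {:L}) i x *: (vbasis {:L})`_i.
Proof. by rewrite -coord_vbasis ?memvf. Qed.

(** A vector in the kernel is a linear relation between the embeddings on a basis, hence on all of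
    [L]. *)
Lemma embedding_mx_unit (f : 'I_(\dim {:L}) -> {rmorphism L -> C}) :
  (forall i j, f i =1 f j -> i = j) ->
  \matrix_(j, i) f i (vbasis {:L})`_j \in unitmx.
Proof.
move=> f_inj; rewrite -unitmx_tr -row_free_unit -kermx_eq0; apply/rowV0P => v.
move/sub_kermxP => vM; apply/rowP => i; rewrite mxE.
apply: (embeddings_independent f_inj) i => x.
rewrite [x]vbasisE.
under eq_bigr do rewrite rmorph_sum mulr_sumr.
rewrite exchange_big big1 // => j _ /=.
have /rowP/(_ j) := vM; rewrite !mxE => vMj.
under eq_bigr do rewrite rmorph_scale_rat mulrCA.
rewrite -mulr_sumr [X in _ * X](_ : _ = 0) ?mulr0 //.
by apply: etrans vMj; apply: eq_bigr => k _; rewrite !mxE.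
Qed.
End Embeddings.

(** * The trace as a sum over embeddings, and integrality *)

Section Trace.
Variable L : fieldExtType rat.
Implicit Types x y : L.

(** Over [C] the matrix [W] of conjugates of the basis diagonalises multiplication by [x]: entry
    [(j, i)] of [A W = W D] reads [f i (x b_j) = f i b_j * f i x]. *)
Lemma field_trace_embeddings (C : numClosedFieldType)
    (f : 'I_(\dim {:L}) -> {rmorphism L -> C}) x :
  (forall i j, f i =1 f j -> i = j) ->
  ratr (field_trace x) = \sum_i f i x.
Proof.
move=> f_inj; set b := vbasis {:L}.
pose W : 'M[C]_(\dim {:L}) := \matrix_(j, i) f i b`_j.
have uW : W \in unitmx := embedding_mx_unit f_inj.
pose A := passmx.mxof b b (amull x).
pose D := diag_mx (\row_i f i x).
have AW : map_mx (ratr : rat -> C) A *m W = W *m D.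
  apply/matrixP => j i; rewrite mul_mx_diag !mxE.
  transitivity (f i (x * b`_j)); last by rewrite rmorphM mulrC.
  rewrite [in RHS](vbasisE (x * b`_j)) rmorph_sum.
  apply: eq_bigr => k _; rewrite !mxE rmorph_scale_rat /=.
  by rewrite passmx.vecof_delta lfunE.
have : \tr (map_mx (ratr : rat -> C) A) = \tr D.
  by rewrite -[map_mx _ A](mulmxK uW) AW mxtrace_mulC mulmxA mulVmx // mul1mx.
rewrite mxtrace_diag trace_map_mx => ->.
by apply: eq_bigr => i _; rewrite mxE.
Qed.

Lemma field_trace_linear : scalar (@field_trace L).
Proof.
move=> c x y; rewrite /field_trace linearP passmx.mxof_linear.
by rewrite mxtraceD mxtraceZ.
Qed.

HB.instance Definition _ :=
  GRing.isLinear.Build rat L rat *%R (@field_trace L) field_trace_linear.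

Lemma field_trace1 : field_trace (1 : L) = (\dim {:L})%:R.
Proof.
have [f [f_inj _]] := exists_embeddings algC L.
apply: (fmorph_inj (ratr : {rmorphism rat -> algC})).
rewrite /= (field_trace_embeddings _ f_inj) rmorph_nat.
under eq_bigr do rewrite rmorph1.
by rewrite sumr_const card_ord.
Qed.

Lemma field_trace_nondegenerate x :
  (forall y, field_trace (x * y) = 0) -> x = 0.
Proof.
move=> h; apply/eqP; apply: contraT => x0.
have := h x^-1; rewrite divff // field_trace1 => /eqP.
by rewrite pnatr_eq0 eqn0Ngt (adim_gt0 (aspacef L)).
Qed.

Lemma integral_rat_int (q : rat) :
  integralOver (intr : int -> rat) q -> q \is a Num.int.
Proof.
move/(integral_rmorphE (ratr : {rmorphism rat -> algC}) q).2 => [p mp rp].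
have : ratr q \in Aint.
  apply: root_monic_Aint rp _ _; first exact: monic_map.
  by apply/polyOverP => i; rewrite coef_map intr_int.
by move/(Cint_rat_Aint (Crat_rat q)); rewrite Cint_rat.
Qed.

Lemma field_trace_int x : ring_of_integers L x -> field_trace x \is a Num.int.
Proof.
move=> hx; apply: integral_rat_int.
apply/(integral_rmorphE (ratr : {rmorphism rat -> algC})) => /=.
have [f [f_inj _]] := exists_embeddings algC L.
rewrite (field_trace_embeddings _ f_inj).
by apply: integral_sum => i _; apply/integral_rmorphE.
Qed.

(* [x] is an eigenvalue of the matrix [N], hence a root of its characteristic
   polynomial. *)
Lemma integral_of_stable_family (I : finType) (e : I -> L) (N : I -> I -> int) x :
  (exists i, e i != 0) -> (forall i, x * e i = \sum_j e j *~ N i j) ->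
  ring_of_integers L x.
Proof.
move=> [i0 ei0] hx.
pose A : 'M[int]_#|I| := \matrix_(i, j) N (enum_val j) (enum_val i).
exists (char_poly A); first exact: char_poly_monic.
rewrite map_char_poly -eigenvalue_root_char.
apply/eigenvalueP; exists (\row_i e (enum_val i)).
  apply/rowP => j; rewrite !mxE hx [RHS](reindex _ (onW_bij _ (@enum_val_bij I))).
  by apply: eq_bigr => i _; rewrite !mxE mulrzr.
apply/eqP => /rowP/(_ (enum_rank i0)); rewrite !mxE enum_rankK => e0.
by rewrite e0 eqxx in ei0.
Qed.

Lemma rat_common_denominator (I : finType) (q : I -> rat) :
  exists2 d : int, d != 0 & forall i, exists n : int, d%:~R * q i = n%:~R.
Proof.
exists (\prod_i denq (q i)); first by apply/prodf_neq0 => i _; rewrite denq_neq0.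
move=> i; exists ((\prod_(j | j != i) denq (q j)) * numq (q i)).
by rewrite (bigD1 i) //= !intrM numqE; ring.
Qed.

(** Once [d] clears the denominators of the matrix of multiplication by [x], the Q-basis is a family
    stable under [x *~ d]. *)
Lemma exists_integral_multiple x :
  exists2 d : int, d != 0 & ring_of_integers L (x *~ d).
Proof.
set b := vbasis {:L}.
have [d d0 hd] := rat_common_denominator
  (fun ij : 'I_(\dim {:L}) * 'I_(\dim {:L}) => coord b ij.2 (x * b`_ij.1)).
exists d => //; have [N NE] := choice hd.
apply: (@integral_of_stable_family 'I_(\dim {:L}) (fun i => b`_i)
  (fun i j => N (i, j))).
  have n0 := adim_gt0 (aspacef L); exists (Ordinal n0).
  apply: (free_not0 (basis_free (vbasisP {:L}))).
  by apply: mem_nth; rewrite size_tuple.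
move=> i; rewrite mulrzAl (vbasisE (x * b`_i)) -/b -scaler_int scaler_sumr.
apply: eq_bigr => j _; rewrite scalerA (NE (i, j)) scaler_int //.
Qed.
End Trace.

(** * Invertibility of finitely generated ideals *)

Section Ideals.
Variable L : fieldExtType rat.
Local Notation O := (ring_of_integers L).
Implicit Types (x y : L) (I J : set L).

Lemma ext_intr_eq0 (d : int) : ((d%:~R : L) == 0) = (d == 0).
Proof. by rewrite -(rmorph_int (in_alg L)) fmorph_eq0 intr_eq0. Qed.

Lemma integer0 : O 0. Proof. exact: integral0. Qed.
Lemma integer1 : O 1. Proof. exact: integral1. Qed.
Lemma integerM x y : O x -> O y -> O (x * y). Proof. exact: integral_mul. Qed.
Lemma integerD x y : O x -> O y -> O (x + y). Proof. exact: integral_add. Qed.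
Lemma integer_int (n : int) : O n%:~R. Proof. exact: integral_id. Qed.

Lemma submoduleMz I x (n : int) : is_integer_submodule I -> I x -> I (x *~ n).
Proof.
move=> [_ _ IM] Ix; rewrite -mulrzl; apply: IM => //; exact: integer_int.
Qed.

Lemma submodule_sum I (T : Type) (r : seq T) (P : pred T) (F : T -> L) :
  is_integer_submodule I -> (forall i, P i -> I (F i)) ->
  I (\sum_(i <- r | P i) F i).
Proof.
move=> [I0 ID _] hF; elim/big_rec: _ => // i x Pi; apply: ID; exact: hF.
Qed.

Lemma integer_submodule : is_integer_submodule O.
Proof. by split; [exact: integer0|exact: integerD|exact: integerM]. Qed.

Lemma ideal_inv_submodule I : is_integer_submodule (ideal_inv I).
Proof.
split=> [y _|x y hx hy z Iz|a x ha hx y Iy].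
- by rewrite mul0r; exact: integer0.
- by rewrite mulrDl; apply: integerD; [exact: hx|exact: hy].
- by rewrite -mulrA; apply: integerM ha (hx _ Iy).
Qed.

Lemma codifferent_submodule : is_integer_submodule (codifferent L).
Proof.
split=> [y _|x y hx hy z Oz|a x ha hx y Oy].
- by rewrite mul0r linear0 rpred0.
- by rewrite mulrDl linearD rpredD ?hx ?hy.
- by rewrite mulrAC mulrC; apply: hx; exact: integerM.
Qed.

Lemma sub_codifferent x : O x -> codifferent L x.
Proof. by move=> Ox y Oy; apply: field_trace_int; exact: integerM. Qed.

Lemma algC_poly_dvd_int (s : seq algC) :
  exists2 h : {poly rat}, h != 0 &
    \prod_(x <- s) ('X - x%:P) %| map_poly (ratr : rat -> algC) h.
Proof.
elim: s => [|x s [h h0 hs]].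
  by exists 1; rewrite ?oner_eq0 // big_nil rmorph1 dvdpp.
have [p [_ mp] px] := minCpolyP x; exists (p * h).
  by rewrite mulf_neq0 // monic_neq0.
by rewrite big_cons rmorphM dvdp_mul // dvdp_XsubCl px dvdpp.
Qed.

(** Over [algC] the polynomial splits and divides a rational one, built from the minimal polynomials
    of its roots; divisibility descends from [algC] to [L], and denominators are then cleared. *)
Lemma poly_dvd_int (f : {poly L}) : f != 0 ->
  exists (h : {poly int}) (g : {poly L}),
    h != 0 /\ f * g = map_poly (intr : int -> L) h.
Proof.
move=> f0; have [emb _] := exists_embeddings algC L.
pose phi := emb (Ordinal (adim_gt0 (aspacef L))).
have [s ds] := closed_field_poly_normal (map_poly phi f).
have [h h0 hs] := algC_poly_dvd_int s.
have : f %| map_poly (in_alg L) h.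
  rewrite -(dvdp_map phi) ds dvdpZl ?lead_coef_eq0 ?map_poly_eq0 //.
  rewrite -map_poly_comp; congr (_ %| _): hs; apply: eq_map_poly => c /=.
  by rewrite rmorph_scale_rat rmorph1 mulr1.
have [q [a a0 hE]] := rat_poly_scale h.
have -> : map_poly (in_alg L) h = a%:~R^-1 *: map_poly (intr : int -> L) q.
  rewrite hE map_polyZ -map_poly_comp; congr (_ *: _).
    by rewrite fmorphV rmorph_int.
  by apply: eq_map_poly => c /=; rewrite scaler_int.
rewrite dvdpZr; last by rewrite invr_eq0 ext_intr_eq0.
move=> /dvdpP[g gE]; exists q, g; split; last by rewrite gE mulrC.
by apply: contra_neq h0 => q0; rewrite hE q0 rmorph0 scaler0.
Qed.

Lemma int_bezout m (a : nat -> int) :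
  exists (n : nat -> int) (d : int), \sum_(i < m) a i * n i = d /\
    forall i, (i < m)%N -> exists e, a i = e * d.
Proof.
elim: m => [|m [n [d [nd hd]]]].
  by exists (fun=> 0), 0; rewrite big_ord0.
have [u [v uv]] := Bezoutz d (a m).
exists (fun i => if (i < m)%N then u * n i else v), (gcdz d (a m)).
split.
  rewrite big_ord_recr /= ltnn -uv -nd mulr_sumr [a m * v]mulrC; congr (_ + _).
  by apply: eq_bigr => i _; rewrite ltn_ord mulrCA.
move=> i; rewrite ltnS leq_eqVlt => /predU1P[->|/hd[e ->]].
  by have /dvdzP[e eE] := dvdz_gcdr d (a m); exists e.
by have /dvdzP[c cE] := dvdz_gcdl d (a m); exists (e * c); rewrite -mulrA -cE.
Qed.

(* [f] divides some nonzero [h] in Z[X]; take [g = h / f] divided by the content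
   of [h]. *)
Lemma poly_content_inverse (f : {poly L}) : f != 0 ->
  exists g : {poly L}, (forall i j, O (f`_i * g`_j)) /\
    exists m (n : nat -> int), \sum_(k < m) (f * g)`_k *~ n k = 1.
Proof.
move=> f0; have [h [g [h0 fg]]] := poly_dvd_int f0.
have [n [d [nd hd]]] := int_bezout (size h) (fun k => h`_k).
have d0 : d != 0.
  apply: contra_neq h0 => d0; apply/polyP => i; rewrite coef0.
  have [/hd[e ->]|/(nth_default 0)->//] := ltnP i (size h).
  by rewrite d0 mulr0.
have d0L : d%:~R != 0 :> L by rewrite ext_intr_eq0.
pose g' := d%:~R^-1 *: g.
have fg' k : (f * g')`_k = d%:~R^-1 * (h`_k)%:~R.
  by rewrite -scalerAr coefZ fg coef_map.
exists g'; split; last first.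
  exists (size h), n; under eq_bigr do rewrite fg' -mulrzr -mulrA -intrM.
  by rewrite -mulr_sumr -rmorph_sum nd mulVf.
have [emb _] := exists_embeddings algC L.
pose phi := emb (Ordinal (adim_gt0 (aspacef L))).
move=> i j; apply/(integral_rmorphE phi); rewrite rmorphM -!coef_map.
apply: integral_coef_prod => k; rewrite -rmorphM coef_map.
apply/integral_rmorphE; rewrite fg'.
have [/hd[e ->]|/(nth_default 0)->] := ltnP k (size h).
  by rewrite intrM mulrCA mulVf // mulr1; exact: integer_int.
by rewrite mulr0; exact: integer0.
Qed.

(** Let [f] have the generators as coefficients and let [g] be its content inverse. The coefficients
    of [g] lie in [ideal_inv I], so [x * g_j] is integral for [x] in the double inverse; writing [1]
    as an integer combination of the [f_i g_j] and multiplying by [x] puts [x] in [I]. *)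
Lemma ideal_inv_inv I m (a : 'I_m -> L) :
  is_integer_submodule I -> (forall i, I (a i)) -> (exists i, a i != 0) ->
  (forall x, I x -> exists c : 'I_m -> int, x = \sum_i a i *~ c i) ->
  ideal_inv (ideal_inv I) = I.
Proof.
move=> hI Ia [i0 ai0] gen; apply/seteqP; split; last first.
  by move=> x Ix y; rewrite mulrC; exact.
move=> x hx; pose f : {poly L} := \poly_(i < m) oapp a 0 (insub i).
have fE (i : 'I_m) : f`_i = a i by rewrite coef_poly ltn_ord valK.
have If i : I f`_i.
  rewrite coef_poly; case: ifP => // [ltim|_]; last by have [] := hI.
  by rewrite insubT; exact: Ia.
have f0 : f != 0 by apply: contra_neq ai0 => f0; rewrite -fE f0 coef0.
have [g [fg [s [n n1]]]] := poly_content_inverse f0.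
have gx j : O (x * g`_j).
  apply: hx => y /gen[c ->]; rewrite mulr_sumr.
  apply: submodule_sum integer_submodule _ => i _; rewrite mulrzAr.
  by apply: submoduleMz integer_submodule _; rewrite mulrC -fE; exact: fg.
rewrite -[x]mulr1 -n1 mulr_sumr; apply: submodule_sum (hI) _ => k _.
rewrite mulrzAr; apply: submoduleMz (hI) _; rewrite coefM mulr_sumr.
apply: submodule_sum (hI) _ => i _; rewrite mulrCA mulrC.
by have [_ _ IM] := hI; apply: IM.
Qed.

(* [I] is generated by [b] and one representative of each of the finitely many
   classes of [d^-1 Z b] modulo [Z b] that it meets. *)
Lemma finitely_generated_between I n (b : 'I_n -> L) (d : nat) :
  is_integer_submodule I -> (0 < d)%N -> (forall i, I (b i)) ->
  (forall x, I x -> exists c : 'I_n -> int, x *+ d = \sum_i b i *~ c i) ->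
  exists m (a : 'I_m -> L), (forall i, I (a i)) /\
    forall x, I x -> exists c : 'I_m -> int, x = \sum_i a i *~ c i.
Proof.
move=> hI d0 Ib hc.
pose T := {ffun 'I_n -> 'I_d}.
pose P (r : T) (x : L) := I x /\ exists c : 'I_n -> int,
  x *+ d = \sum_i b i *~ ((r i)%:Z + d%:Z * c i).
have [rep repP] : exists rep : T -> L, forall r, I (rep r) /\
    forall x, P r x -> P r (rep r).
  have : forall r, exists y, I y /\ forall x, P r x -> P r y.
    move=> r; have [[x Px]|nP] := pselect (exists x, P r x).
      by exists x; split => //; case: Px.
    by exists 0; split => [|x Px]; [have [] := hI|case: nP; exists x].
  by move=> /choice[rep ?]; exists rep.
suff gen (S : finType) (a : S -> L) : (forall i, I (a i)) ->
    (forall x, I x -> exists c : S -> int, x = \sum_i a i *~ c i) ->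
    exists m (a : 'I_m -> L), (forall i, I (a i)) /\
      forall x, I x -> exists c : 'I_m -> int, x = \sum_i a i *~ c i.
  apply: (gen (T + 'I_n)%type
    (fun k => match k with inl r => rep r | inr i => b i end)).
    by case=> [r|i]; [have [] := repP r|exact: Ib].
  move=> x Ix; have [c cE] := hc x Ix.
  have rd i : (`|(c i %% d%:Z)%Z| < d)%N.
    by rewrite -ltz_nat gez0_abs ?ltz_pmod ?modz_ge0 // -lt0n.
  pose r : T := [ffun i => Ordinal (rd i)].
  have rE i : c i = (r i)%:Z + d%:Z * (c i %/ d%:Z)%Z.
    rewrite ffunE /= gez0_abs ?modz_ge0 // -?lt0n //.
    by rewrite addrC mulrC -divz_eq.
  have Pr : P r x.
    by split => //; exists (fun i => (c i %/ d%:Z)%Z); under eq_bigr do rewrite -rE.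
  have [_ [c' c'E]] := (repP r).2 x Pr.
  (* [x] and [rep r] have the same residues, so [d] times their difference is [d] times an integer
     combination of the [b i]; cancelling [d] gives these coefficients. *)
  exists (fun k => match k with inl s => (s == r)%:Z
    | inr i => (c i %/ d%:Z)%Z - c' i end).
  rewrite big_sumType /= (bigD1 r) //= eqxx mulr1z big1 ?addr0; last first.
    by move=> s /negPf ->.
  have dn0 : (d%:R : L) != 0 by rewrite (ext_intr_eq0 d) -lt0n.
  apply: (mulIf dn0); rewrite mulrDl !mulr_natr c'E cE -sumrMnl -big_split /=.
  apply: eq_bigr => i _; rewrite [in LHS]rE -[_ *+ d]/(_ *~ d%:Z) -mulrzA.
  by rewrite -mulrzDr; congr (_ *~ _); ring.
move=> Ia ha; exists #|S|, (fun i => a (enum_val i)); split=> [i|x /ha[c ->]].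
  exact: Ia.
exists (fun i => c (enum_val i)).
by rewrite (reindex _ (onW_bij _ (@enum_val_bij S))).
Qed.
End Ideals.

(** * Finite generation and double inverse of the codifferent *)

Section Codifferent.
Variable L : fieldExtType rat.

Lemma common_integral_multiple (I : finType) (a : I -> L) :
  exists2 d : int, d != 0 & forall i, ring_of_integers L (a i *~ d).
Proof.
have /choice[e eP] : forall i, exists e : int,
    e != 0 /\ ring_of_integers L (a i *~ e).
  by move=> i; have [e ? ?] := exists_integral_multiple (a i); exists e.
exists (\prod_i e i); first by apply/prodf_neq0 => i _; have [] := eP i.
move=> i; rewrite (bigD1 i) //= mulrzA; have [_ h] := eP i.
exact: submoduleMz (@integer_submodule L) h.
Qed.

(** A Q-basis made of algebraic integers, not a Z-basis of the ring of integers: a suitable multiple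
    of any Q-basis will do. *)
Lemma exists_integral_basis :
  exists b : 'I_(\dim {:L}) -> L,
    [/\ forall i, ring_of_integers L (b i),
        forall x, exists q : 'I_(\dim {:L}) -> rat, x = \sum_i q i *: b i
      & forall q : 'I_(\dim {:L}) -> rat, \sum_i q i *: b i = 0 ->
          forall i, q i = 0].
Proof.
have [d d0 dO] :=
  common_integral_multiple (fun i : 'I_(\dim {:L}) => (vbasis {:L})`_i).
exists (fun i : 'I__ => (vbasis {:L})`_i *~ d); split=> [//|x|q].
- exists (fun i : 'I__ => coord (vbasis {:L}) i x / d%:~R).
  rewrite {1}[x]vbasisE; apply: eq_bigr => i _.
  by rewrite -scaler_int scalerA divfK // intr_eq0.
under eq_bigr do rewrite -scaler_int scalerA.
move=> q0 i.
have /freeP/(_ _ q0)/(_ i)/eqP := basis_free (vbasisP {:L}).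
by rewrite mulf_eq0 intr_eq0 (negPf d0) orbF => /eqP.
Qed.

(** With [G] the Gram matrix of the trace form on [b], the coordinates of [x] are [t G^-1], where
    [t] lists the integers [Tr (x b_j)]. A common denominator [d] of [G^-1] then places the
    codifferent between the Z-span of [b] and [d^-1] times that span. *)
Lemma codifferent_finitely_generated :
  exists m (a : 'I_m -> L), (forall i, codifferent L (a i)) /\
    forall x, codifferent L x ->
      exists c : 'I_m -> int, x = \sum_i a i *~ c i.
Proof.
have [b [Ob gen ind]] := exists_integral_basis.
pose G := \matrix_(i, j) field_trace (b i * b j).
have traceG (q : 'I__ -> rat) k :
    field_trace ((\sum_j q j *: b j) * b k) = ((\row_j q j) *m G) 0 k.
  rewrite mulr_suml linear_sum mxE; apply: eq_bigr => j _.
  by rewrite !mxE -scalerAl linearZ.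
have uG : G \in unitmx.
  rewrite -row_free_unit -kermx_eq0; apply/rowV0P => v /sub_kermxP vG.
  have v0 : \sum_j v 0 j *: b j = 0.
    apply: field_trace_nondegenerate => y; have [q ->] := gen y.
    rewrite mulr_sumr linear_sum big1 // => k _; rewrite -scalerAr linearZ /= traceG.
    rewrite (_ : \row_j v 0 j = v) ?vG ?mxE ?mulr0 //.
    by apply/rowP => j; rewrite mxE.
  by apply/rowP => i; rewrite mxE; exact: (ind _ v0).
have [d d0 hd] := rat_common_denominator
  (fun ij : 'I_(\dim {:L}) * 'I_(\dim {:L}) => invmx G ij.1 ij.2).
have [N NE] := choice hd.
apply: (@finitely_generated_between _ _ _ b `|d|%N).
- exact: codifferent_submodule.
- by rewrite absz_gt0.
- by move=> i; exact: sub_codifferent.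
move=> x hx; have [q xq] := gen x.
have /choice[t tE] : forall k, exists t : int, field_trace (x * b k) = t%:~R.
  by move=> k; apply/intrP; exact: hx.
(* [finitely_generated_between] takes a natural denominator, so [d] is replaced with its absolute
   value and its sign moves into the coefficients. *)
exists (fun k => sgz d * \sum_j t j * N (j, k)).
rewrite -[x *+ _]/(x *~ `|d|%N%:Z) abszEsg -mulrzA_C -[x *~ d]scaler_int.
rewrite xq scaler_sumr mulrz_suml; apply: eq_bigr => k _.
rewrite -mulrzA_C scalerA; congr (_ *~ _); rewrite -[RHS]scaler_int; congr (_ *: _).
have -> : q k = (\row_j (t j)%:~R *m invmx G) 0 k.
  rewrite -[\row_j (t j)%:~R](_ : (\row_j q j) *m G = _) ?mulmxK ?mxE //.
  by apply/rowP => j; rewrite -traceG -xq tE mxE.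
rewrite mxE mulr_sumr rmorph_sum; apply: eq_bigr => j _ /=.
by rewrite mxE intrM -(NE (j, k)) mulrCA.
Qed.

(** The hypothesis says that [x] is in the double inverse of the codifferent; the nonzero generator
    that [ideal_inv_inv] asks for exists because [1] is in the codifferent. *)
Lemma codifferent_reflexive x :
  (forall y, different L y -> ring_of_integers L (x * y)) -> codifferent L x.
Proof.
have [m [a [aC gen]]] := codifferent_finitely_generated => hx.
suff <- : ideal_inv (different L) = codifferent L by [].
apply: (ideal_inv_inv (@codifferent_submodule L) aC _ gen).
apply: contrapT => a0; have [c] := gen 1 (sub_codifferent (integer1 L)).
rewrite big1 => [/eqP|i _]; first by rewrite oner_eq0.
apply/eqP; apply: contraT => nz; case: a0; exists i.
by apply: contraNneq nz => ->; rewrite mul0rz.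
Qed.

Lemma codifferent_of_principal_different (d : L) :
  different L = principal_ideal d ->
  d != 0 /\ forall x, codifferent L x <-> ring_of_integers L (d * x).
Proof.
move=> dE; have Dd : different L d.
  by rewrite dE; exists 1; [exact: integer1|rewrite mulr1].
have d0 : d != 0.
  (* A common denominator [e] of the generators of the codifferent is a nonzero element of the
     different, which excludes [d = 0]. *)
  apply/eqP => d0; have [m [a [aC gen]]] := codifferent_finitely_generated.
  have [e e0 eO] := common_integral_multiple a.
  have De : different L e%:~R.
    move=> y /gen[c ->]; rewrite mulr_sumr.
    apply: submodule_sum (@integer_submodule L) _ => i _.
    by rewrite mulrzAr mulrzl; exact: submoduleMz (@integer_submodule L) (eO i).
  move: De; rewrite dE => -[y _]; rewrite d0 mul0r => /esym/eqP.
  by rewrite ext_intr_eq0 (negPf e0).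
split => // x; split=> [Cx|Ox]; first exact: Dd.
apply: codifferent_reflexive => y; rewrite dE => -[o Oo <-].
by rewrite mulrA [x * d]mulrC; exact: integerM.
Qed.
End Codifferent.

(** * Complex conjugation and CM types *)

Section CMConjugation.
Variables (R : realType) (K : fieldExtType rat).
Implicit Types (phi : {rmorphism K -> R[i]}) (x y : K).

Lemma exists_embedding : exists phi : {rmorphism K -> R[i]}, True.
Proof.
have [emb _] := exists_embeddings R[i] K.
by exists (emb (Ordinal (adim_gt0 (aspacef K)))).
Qed.

Lemma totally_real_Im (F : {subfield K}) phi x :
  totally_real R (subvs_of F) -> x \in F -> complex.Im (phi x) = 0.
Proof. by move=> hF xF; have := hF (phi \o vsval) (Subvs xF). Qed.

Lemma conjc_real (c : R[i]) : complex.Im c = 0 -> c^* = c.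
Proof. by case: c => a b /= ->; rewrite oppr0. Qed.

Lemma conjc_imaginary (c : R[i]) : complex.Re c = 0 -> c^* = - c.
Proof. by case: c => a b /= ->; apply/eqP; rewrite eq_complex /= oppr0 !eqxx. Qed.

Lemma quadratic_extension_sqrt (F : {subfield K}) : \dim_F {:K} = 2%N ->
  exists eta, eta ^+ 2 \in F /\
    forall x, exists a b, [/\ a \in F, b \in F & x = a + b * eta].
Proof.
move=> dimF.
have dimK : \dim {:K} = (2 * \dim F)%N by rewrite -dimF divnK // field_dimS // subvf.
have [theta thF] : exists theta, theta \notin F.
  apply: contrapT => nth; have : ({:K} <= F)%VS.
    by apply/subvP => x _; apply: contrapT => xF; apply: nth; exists x; apply/negP.
  by move/dimvS; rewrite dimK -[leqRHS]mul1n leq_pmul2r ?adim_gt0.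
have dF := dim_Fadjoin F theta.
have deg2 : adjoin_degree F theta = 2%N.
  have := dimvS (subvf <<F; theta>>); rewrite dF dimK leq_pmul2r ?adim_gt0 //.
  rewrite -adjoin_deg_eq1 in thF.
  have := isT : (0 < adjoin_degree F theta)%N.
  by case: (adjoin_degree F theta) thF => [|[|[]]].
have fullF x : x \in <<F; theta>>%VS.
  suff -> : <<F; theta>>%VS = {:K}%VS by rewrite memvf.
  by apply/eqP; rewrite eqEdim subvf /= dF deg2 dimK.
set p := minPoly F theta.
have pF i : p`_i \in F by have /polyOverP := minPolyOver F theta; exact.
have sp : size p = 3%N by rewrite /p size_minPoly deg2.
have p2 : p`_2 = 1 by have := monic_minPoly F theta => /monicP; rewrite lead_coefE sp.
have th2 : theta ^+ 2 = - (p`_0 + p`_1 * theta).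
  have := minPolyxx F theta; rewrite horner_coef -/p sp !big_ord_recl big_ord0 /=.
  rewrite p2 => h; apply/eqP; rewrite -subr_eq0 opprK -[X in _ == X]h; apply/eqP.
  by rewrite /bump /=; ring.
have h2 : (2%:R : K) != 0 by rewrite (ext_intr_eq0 K 2).
have h2F : (2%:R : K)^-1 \in F by rewrite rpredV rpred_nat.
(* Completing the square in the minimal polynomial [X^2 + p_1 X + p_0] of [theta]. *)
exists (theta + p`_1 / 2%:R); split.
  have -> : (theta + p`_1 / 2%:R) ^+ 2 = theta ^+ 2 + p`_1 * theta + (p`_1 / 2%:R) ^+ 2.
    by field.
  by rewrite th2 opprD addrNK rpredD ?rpredN // rpredX // rpredM.
move=> x; pose q := Fadjoin_poly F theta x.
have qF i : q`_i \in F by have /polyOverP := Fadjoin_polyOver F theta x; exact.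
exists (q`_0 - q`_1 * (p`_1 / 2%:R)), q`_1; split => //.
  by rewrite rpredB // !rpredM.
rewrite -[LHS](Fadjoin_poly_eq (fullF x)) -/q.
rewrite (horner_coef_wide (n := 2)) ?big_ord_recl ?big_ord0 /=.
  by rewrite /bump /=; ring.
by rewrite -deg2 size_Fadjoin_poly.
Qed.

(** Conjugation is [a + b eta |-> a - b eta]. Each embedding is real on [F], and it sends [eta] to
    the imaginary axis: [phi eta] has a real square, and were it real itself, [phi] would be real on
    all of [K]. *)
Lemma cm_conj_exists : is_CM_field R K ->
  exists F : {subfield K}, [/\ totally_real R (subvs_of F),
     \dim {:K} = (2 * \dim F)%N,
     forall x, exists y, forall phi, phi y = (phi x)^* &
     forall x, (forall phi, (phi x)^* = phi x) -> x \in F].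
Proof.
move=> [imK [F realF dimF]]; exists F.
have dimK : \dim {:K} = (2 * \dim F)%N by rewrite -dimF divnK // field_dimS // subvf.
have [eta [eta2 gen]] := quadratic_extension_sqrt dimF.
have conjF phi x : x \in F -> (phi x)^* = phi x.
  by move=> xF; apply: conjc_real; exact: totally_real_Im realF xF.
have eta_im phi : complex.Re (phi eta) = 0.
  have Im_eta : complex.Im (phi eta) != 0.
    apply/eqP => im0; have [x /eqP] := imK phi; apply.
    have [a [b [aF bF ->]]] := gen x; rewrite rmorphD rmorphM.
    have := totally_real_Im phi realF aF; have := totally_real_Im phi realF bF.
    move: im0; case: (phi eta) => ? ? /= ->; case: (phi a) => ? ? /=.
    by case: (phi b) => ? ? /= -> ->; rewrite mul0r mulr0 !addr0.
  have := totally_real_Im phi realF eta2; rewrite rmorphXn expr2.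
  move: Im_eta; case: (phi eta) => u v /= v0 /eqP.
  rewrite [v * u]mulrC -mulr2n mulrn_eq0 /= mulf_eq0 (negPf v0) orbF.
  by move/eqP.
have conj_eta phi : (phi eta)^* = - phi eta by exact: conjc_imaginary.
split => // [x|x xfix].
  have [a [b [aF bF ->]]] := gen x; exists (a - b * eta) => phi.
  rewrite rmorphB rmorphM !rmorphD /= !rmorphM /=.
  by rewrite (conjF _ _ aF) (conjF _ _ bF) conj_eta mulrN.
have [a [b [aF bF xE]]] := gen x; have [phi _] := exists_embedding.
have := xfix phi; rewrite xE !rmorphD !rmorphM /=.
rewrite (conjF _ _ aF) (conjF _ _ bF) conj_eta mulrN => /addrI/esym/eqP.
rewrite -subr_eq0 opprK -mulr2n mulrn_eq0 /= -rmorphM fmorph_eq0 => /eqP ->.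
by rewrite addr0.
Qed.

(** The subfield [F] given by the CM property is the whole fixed field of conjugation. Being totally
    real, [K0] lies in [F], and maximality makes them equal. *)
Lemma cm_conj_rmorphism (K0 : {subfield K}) :
  is_CM_field R K -> is_maximal_totally_real R K0 ->
  exists s : {rmorphism K -> K},
    [/\ @cm_conj R K = s :> (K -> K), forall phi x, phi (s x) = (phi x)^*,
        forall x, (x \in K0) = (s x == x) & \dim {:K} = (2 * \dim K0)%N].
Proof.
move=> hK [realK0 maxK0].
have [F [realF dimK conjP fixP]] := cm_conj_exists hK.
have cmP phi x : phi (cm_conj R x) = (phi x)^*.
  rewrite /cm_conj; have [y hy] := conjP x.
  by move: phi; apply: (@xgetPex _ _ [set y | forall phi, phi y = (phi x)^*]); exists y.
have [phi0 _] := exists_embedding.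
have sB : zmod_morphism (@cm_conj R K).
  by move=> x y; apply: (fmorph_inj phi0); rewrite !(cmP, rmorphB).
have sM : monoid_morphism (@cm_conj R K).
  by split=> [|x y]; apply: (fmorph_inj phi0); rewrite !(cmP, rmorphM, rmorph1).
pose s : {rmorphism K -> K} := HB.pack (@cm_conj R K)
  (GRing.isZmodMorphism.Build _ _ _ sB) (GRing.isMonoidMorphism.Build _ _ _ sM).
have K0F : (K0 <= F)%VS.
  apply/subvP => x xK0; apply: fixP => phi; apply: conjc_real.
  exact: totally_real_Im realK0 xK0.
have FK0 := maxK0 F realF K0F.
exists s; split => // [x|]; last first.
  by rewrite dimK (_ : \dim K0 = \dim F) //; apply/eqP; rewrite eqn_leq !dimvS.
apply/idP/eqP => [xK0|sx].
  apply: (fmorph_inj phi0); rewrite cmP; apply: conjc_real.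
  exact: totally_real_Im realK0 xK0.
by apply: (subvP FK0); apply: fixP => phi; rewrite -cmP [cm_conj R x]sx.
Qed.
End CMConjugation.

(** Apart from the function, a bundled morphism contains only proofs. CM types are sets of bundled
    morphisms, so pointwise equality has to be upgraded. *)
Lemma rmorphism_eq (A B : pzRingType) (f h : {rmorphism A -> B}) :
  f =1 h -> f = h.
Proof.
case: f h => f [[[f0 fD]] [[f1 fM]]] [h [[[h0 hD]] [[h1 hM]]]] /= /funext fh.
move: h0 hD h1 hM; rewrite -{}fh => h0 hD h1 hM.
by rewrite (Prop_irrelevance h0 f0) (Prop_irrelevance hD fD)
  (Prop_irrelevance h1 f1) (Prop_irrelevance hM fM).
Qed.

(** * The CM type cut out by an element [xi] with [s xi = - xi], and the form [E_xi] *)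

Section CMType.
Variables (R : realType) (g : nat) (K : fieldExtType rat) (K0 : {subfield K}).
Variables (s : {rmorphism K -> K}) (xi : K).
Hypothesis sE : forall (phi : {rmorphism K -> R[i]}) x, phi (s x) = (phi x)^*.
Hypothesis K0E : forall x, (x \in K0) = (s x == x).
Hypothesis dimK0 : \dim K0 = g.
Hypothesis dimK : \dim {:K} = (2 * g)%N.
Hypothesis xi_neq0 : xi != 0.
Hypothesis s_xi : s xi = - xi.
Local Notation emb := {rmorphism K -> R[i]}.
Local Notation Phi := [set phi : emb | 0 < complex.Im (phi xi)].
Implicit Types (phi psi : emb).

Lemma conj_embeddingE phi x : conj_embedding phi x = (phi x)^*.
Proof. by []. Qed.

Lemma conj_embeddingK : involutive (@conj_embedding R K).
Proof. by move=> phi; apply: rmorphism_eq => x /=; rewrite conjcK. Qed.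

Lemma Re_xi phi : complex.Re (phi xi) = 0.
Proof.
have := sE phi xi; rewrite s_xi rmorphN; case: (phi xi) => u v /eqP.
by rewrite eq_complex /= => /andP[/eqP h _]; lra.
Qed.

Lemma Im_xi_neq0 phi : complex.Im (phi xi) != 0.
Proof.
apply: contra_neq xi_neq0 => im0; apply: (fmorph_inj phi); rewrite rmorph0.
by apply/eqP; rewrite eq_complex /= Re_xi im0 !eqxx.
Qed.

Lemma conj_Phi phi : Phi (conj_embedding phi) <-> ~ Phi phi.
Proof.
rewrite /= /conjc; have := Im_xi_neq0 phi; case: (phi xi) => u v /= v0.
rewrite oppr_gt0; split=> [lt gt|/negP]; first by lra.
by rewrite -leNgt le_eqVlt (negPf v0).
Qed.

Lemma Phi_cover : Phi `|` (@conj_embedding R K) @` Phi = [set: emb].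
Proof.
apply/seteqP; split => // phi _; have [h|h] := pselect (Phi phi); first by left.
right; exists (conj_embedding phi); first exact/conj_Phi.
exact: conj_embeddingK.
Qed.

(** Conjugation permutes the [2g] embeddings and exchanges [Phi] with its complement, so [Phi] has
    [g] elements. *)
Lemma Phi_enum : exists phi : 'I_g -> emb, set_bij [set: 'I_g] Phi phi.
Proof.
have [e [e_inj e_surj]] := exists_embeddings R[i] K.
have e_eq i j : e i = e j -> i = j by move=> h; apply: e_inj; rewrite h.
have /choice[c cE] : forall i, exists j, conj_embedding (e i) = e j.
  by move=> i; have [j h] := e_surj (conj_embedding (e i)); exists j; exact: rmorphism_eq.
pose A := [set i | `[< Phi (e i) >]]%SET.
have AE i : (i \in A) = `[< Phi (e i) >] by rewrite inE.
have c_inj : injective c.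
  move=> i j cij; apply: e_eq; apply: (can_inj conj_embeddingK).
  by rewrite !cE cij.
have cA : c @: A = ~: A.
  apply/setP => j; rewrite inE AE; apply/imsetP/asboolPn => [[i + ->] | nPj].
    by rewrite AE -cE => /asboolP Pi /conj_Phi.
  have [i iE] := e_surj (conj_embedding (e j)).
  have eiE : e i = conj_embedding (e j) by apply: rmorphism_eq => x; rewrite iE.
  exists i; first by rewrite AE; apply/asboolP; rewrite eiE; apply/conj_Phi.
  by apply: e_eq; rewrite -cE eiE conj_embeddingK.
have cardA : #|A| = g.
  have : (#|A| + #|A| = 2 * g)%N.
    by rewrite -dimK -[RHS]card_ord -(cardsC A) -cA card_imset.
  by rewrite addnn -mul2n => /eqP; rewrite eqn_pmul2l // => /eqP.
exists (fun k => e (enum_val (cast_ord (esym cardA) k))); split=> [k _ | k l _ _ | phi].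
- by have := enum_valP (cast_ord (esym cardA) k); rewrite AE => /asboolP.
- by move/e_eq/enum_val_inj/cast_ord_inj.
have [i iE] := e_surj phi; have phiE := rmorphism_eq iE => Pphi.
have iA : i \in A by rewrite AE; apply/asboolP; rewrite -phiE.
exists (cast_ord cardA (enum_rank_in iA i)) => //.
by rewrite cast_ordK enum_rankK_in.
Qed.

Lemma Phi_CM_type : is_CM_type g Phi.
Proof.
split; last exact: Phi_cover.
have [f] : $| {bij [set: 'I_g] >-> Phi} | by apply/bijPex; exact: Phi_enum.
apply: card_eq_trans (_ : [set: 'I_g] #= _)%card; last first.
  by rewrite card_eq_sym; exact: card_II.
by rewrite card_eq_sym; exact: pcard_eq f.
Qed.

Section Enumerated.
Variable phi : 'I_g -> emb.
Hypothesis phi_bij : set_bij [set: 'I_g] Phi phi.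

Lemma phi_inj i j : phi i =1 phi j -> i = j.
Proof.
move=> /rmorphism_eq; have [_ inj _] := phi_bij.
by apply: inj; rewrite in_setE.
Qed.

Lemma phi_Phi i : Phi (phi i).
Proof. by have [fP _ _] := phi_bij; exact: fP. Qed.

(** The CM type followed by its conjugates: as these are distinct and [g + g] is the degree, they
    can serve as the embeddings in the trace formula for [K]. *)
Definition all_embeddings (k : 'I_(g + g)) : emb :=
  match fintype.split k with inl i => phi i | inr i => conj_embedding (phi i) end.

Lemma all_embeddings_l i : all_embeddings (lshift g i) = phi i.
Proof. by rewrite /all_embeddings (fintype.unsplitK (inl i)). Qed.

Lemma all_embeddings_r i : all_embeddings (rshift g i) = conj_embedding (phi i).
Proof. by rewrite /all_embeddings (fintype.unsplitK (inr i)). Qed.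

Lemma all_embeddings_inj j k : all_embeddings j =1 all_embeddings k -> j = k.
Proof.
rewrite -[j]fintype.splitK -[k]fintype.splitK.
case: (fintype.split j) (fintype.split k) => i [] l.
- by rewrite !all_embeddings_l => /phi_inj ->.
- rewrite all_embeddings_l all_embeddings_r => /rmorphism_eq e.
  by have := phi_Phi i; rewrite e => /conj_Phi; have := phi_Phi l.
- rewrite all_embeddings_l all_embeddings_r => /rmorphism_eq e.
  by have := phi_Phi l; rewrite -e => /conj_Phi; have := phi_Phi i.
- rewrite !all_embeddings_r => /rmorphism_eq/(can_inj conj_embeddingK) e.
  by rewrite (@phi_inj i l) // e.
Qed.

Lemma dimKgg : (g + g)%N = \dim {:K}.
Proof. by rewrite dimK addnn mul2n. Qed.

(** Allows an index type ['I_n] whose size is only provably equal to the degree. *)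
Lemma field_trace_embeddings_cast (C : numClosedFieldType)
    (L : fieldExtType rat) n (f : 'I_n -> {rmorphism L -> C}) x :
  n = \dim {:L} -> (forall i j, f i =1 f j -> i = j) ->
  ratr (field_trace x) = \sum_i f i x.
Proof. by move=> en; subst n; exact: field_trace_embeddings. Qed.

Lemma Re_sum (I : Type) (r : seq I) (P : pred I) (F : I -> R[i]) :
  complex.Re (\sum_(i <- r | P i) F i) = \sum_(i <- r | P i) complex.Re (F i).
Proof. by apply: (big_morph (@complex.Re R)) => // -[? ?] []. Qed.

Lemma Re_ratr (q : rat) : complex.Re (ratr q : R[i]) = ratr q.
Proof. by rewrite -[X in complex.Re X](fmorph_eq_rat (real_complex R \o ratr)). Qed.

Lemma field_trace_CM x : ratr (field_trace x) = \sum_i 2%:R * complex.Re (phi i x).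
Proof.
rewrite -Re_ratr (field_trace_embeddings_cast x dimKgg all_embeddings_inj).
rewrite big_split_ord /= -big_split /= Re_sum; apply: eq_bigr => i _.
rewrite all_embeddings_l all_embeddings_r /= -/(conjc _).
by case: (phi i x) => u v /=; ring.
Qed.

Lemma dim_subvs_K0 : g = \dim {:subvs_of K0}.
Proof. by rewrite dimvf /= -dimK0. Qed.

Lemma two_neq0 : (2%:R : K) != 0.
Proof. by rewrite (ext_intr_eq0 K 2). Qed.

Lemma s_involutive : involutive s.
Proof.
have [f _] := exists_embedding R K.
by move=> x; apply: (fmorph_inj f); rewrite !sE conjcK.
Qed.

Lemma eq_embedding_K0 (f h : emb) :
  (forall x, x \in K0 -> f x = h x) -> f xi = h xi -> f = h.
Proof.
move=> fh0 fhxi; apply: rmorphism_eq => x.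
(* The symmetric and antisymmetric parts of [x] under [s]; dividing the latter by [xi], which [s]
   negates, brings it into [K0]. *)
have hx : x = (x + s x) / 2%:R + (x - s x) / (2%:R * xi) * xi.
  by field; rewrite xi_neq0 two_neq0.
have m1 : (x + s x) / 2%:R \in K0.
  by rewrite K0E fmorph_div rmorphD s_involutive rmorph_nat addrC.
have m2 : (x - s x) / (2%:R * xi) \in K0.
  rewrite K0E fmorph_div rmorphB rmorphM s_involutive rmorph_nat /= s_xi.
  by rewrite mulrN invrN mulrN -mulNr opprB.
by rewrite hx (rmorphD f) (rmorphD h) (rmorphM f _ xi) (rmorphM h _ xi) fhxi !fh0.
Qed.

(* The [phi i] restrict to [g] distinct embeddings of [K0]: as [xi ^+ 2] is in
   [K0] and [phi i xi] is on the positive imaginary axis, the restriction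
   determines [phi i xi], and [K = K0 + K0 xi]. *)
Lemma field_trace_K0 (t : subvs_of K0) :
  ratr (field_trace t) = \sum_i phi i (vsval t).
Proof.
apply: (@field_trace_embeddings_cast _ _ _ (fun i => phi i \o vsval)).
  exact: dim_subvs_K0.
move=> i j eij; apply: phi_inj => x; rewrite (_ : phi i = phi j) //.
have e0 y : y \in K0 -> phi i y = phi j y by move=> yK; exact: (eij (Subvs yK)).
apply: eq_embedding_K0 => //.
have := e0 (xi ^+ 2); rewrite K0E rmorphXn /= s_xi sqrrN eqxx => /(_ isT).
have := phi_Phi i; have := phi_Phi j; rewrite !rmorphXn /= !expr2.
have := Re_xi (phi i); have := Re_xi (phi j).
case: (phi i xi) => a b; case: (phi j xi) => c d /= -> -> d0 b0 /eqP.
rewrite eq_complex /= !mul0r !sub0r => /andP[/eqP h _].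
by congr (_ +i* _); nra.
Qed.

(** Both traces are sums over the same [phi i]: in [K] each conjugate pair contributes
    [2 Re (phi i x)], which is also [phi i (x + s x)]. *)
Lemma field_trace_tower x (t : subvs_of K0) :
  vsval t = x + s x -> field_trace x = field_trace t.
Proof.
move=> tE; apply: (fmorph_inj (ratr : {rmorphism rat -> R})) => /=.
rewrite field_trace_CM -Re_ratr field_trace_K0 Re_sum; apply: eq_bigr => i _.
by rewrite tE rmorphD sE; case: (phi i x) => u v /=; ring.
Qed.

Lemma CM_vec_inj : (0 < g)%N -> injective (CM_vec phi).
Proof.
move=> g0 x y /rowP/(_ (Ordinal g0)); rewrite !mxE; exact: fmorph_inj.
Qed.

(* Solve over C for all [2g] embeddings with right-hand side [(u, conj u)]; the
   real parts of the solution still give [u]. *)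
Lemma CM_vec_span (u : 'rV[R[i]]_g) :
  exists r : 'I_(\dim {:K}) -> R,
    u = \sum_j (r j)%:C *: CM_vec phi (vbasis {:K})`_j.
Proof.
pose f (k : 'I_(\dim {:K})) := all_embeddings (cast_ord (esym dimKgg) k).
have f_inj i j : f i =1 f j -> i = j.
  by move=> /all_embeddings_inj/cast_ord_inj.
pose W : 'M[R[i]]_(\dim {:K}) := \matrix_(j, i) f i (vbasis {:K})`_j.
have uW : W \in unitmx := embedding_mx_unit f_inj.
pose t : 'rV[R[i]]_(g + g) := row_mx u (map_mx conjc u).
have [c cW] : exists c : 'rV[R[i]]_(\dim {:K}), forall k,
    \sum_j c 0 j * all_embeddings k (vbasis {:K})`_j = t 0 k.
  exists (castmx (erefl, dimKgg) t *m invmx W) => k.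
  set c := _ *m _; have -> : t 0 k = (c *m W) 0 (cast_ord dimKgg k).
    by rewrite mulmxKV // castmxE /= cast_ord_id cast_ordK.
  rewrite [RHS]mxE; apply: eq_bigr => j _; congr (_ * _).
  by rewrite mxE /f cast_ordK.
exists (fun j => complex.Re (c 0 j)); apply/rowP => i.
rewrite summxE; under eq_bigr do rewrite !mxE.
have h1 := cW (lshift g i); have h2 := cW (rshift g i).
rewrite all_embeddings_l row_mxEl in h1.
rewrite all_embeddings_r row_mxEr mxE in h2.
have h3 : u 0 i = \sum_j (c 0 j)^* * phi i (vbasis {:K})`_j.
  rewrite -[LHS]conjcK -h2 rmorph_sum; apply: eq_bigr => j _.
  by rewrite rmorphM conj_embeddingE [X in _ * X]conjcK.
have two0 : (2%:R : R[i]) != 0 by rewrite pnatr_eq0.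
apply: (mulfI two0); rewrite [in LHS]mulr_natl mulr2n {1}h3 -h1 -big_split /=.
rewrite mulr_sumr; apply: eq_bigr => j _; rewrite -mulrDl mulrA; congr (_ * _).
rewrite mulr_natl mulr2n; case: (c 0 j) => a b.
by apply/eqP; rewrite eq_complex /= addr0 addNr !eqxx.
Qed.

Lemma Re_linear (r : R) (a b : R[i]) :
  complex.Re (r%:C * a + b) = r * complex.Re a + complex.Re b.
Proof. by case: a b => a a' [b b'] /=; ring. Qed.

Lemma conjc_linear (r : R) (a b : R[i]) :
  (r%:C * a + b)^* = r%:C * a^* + b^*.
Proof.
case: a b => a a' [b b']; apply/eqP; rewrite eq_complex /=.
by apply/andP; split; apply/eqP; ring.
Qed.

(** The sum over all [2g] embeddings that computes the trace, each conjugate pair being collapsed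
    into twice a real part; in this shape it makes sense on all of [C^g]. *)
Definition CM_form (u v : 'rV[R[i]]_g) : R :=
  \sum_i 2%:R * complex.Re (phi i xi * u 0 i * (v 0 i)^*).

Lemma CM_form_E : @cm_conj R K = s :> (K -> K) -> is_E_form phi xi CM_form.
Proof.
move=> cmE; split; first split=> r u v w.
- rewrite /CM_form mulr_sumr -big_split /=; apply: eq_bigr => i _; rewrite !mxE.
  rewrite [r * (_ * _)]mulrCA -mulrDr -Re_linear; congr (_ * complex.Re _); ring.
- rewrite /CM_form mulr_sumr -big_split /=; apply: eq_bigr => i _; rewrite !mxE.
  rewrite [r * (_ * _)]mulrCA -mulrDr -Re_linear; congr (_ * complex.Re _).
  transitivity (phi i xi * w 0 i * (r%:C * (u 0 i)^* + (v 0 i)^*)).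
    by congr (_ * _); exact: conjc_linear.
  by ring.
move=> x y; rewrite field_trace_CM; apply: eq_bigr => i _.
by rewrite !mxE !rmorphM /= cmE sE.
Qed.

Lemma real_bilinear_suml (E : 'rV[R[i]]_g -> 'rV[R[i]]_g -> R)
    n (r : 'I_n -> R) (a : 'I_n -> 'rV[R[i]]_g) w :
  is_real_bilinear E ->
  E (\sum_j (r j)%:C *: a j) w = \sum_j r j * E (a j) w.
Proof.
move=> [El _]; have E0 : E 0 w = 0.
  by have := El 1 0 0 w; rewrite scaler0 addr0 mul1r; lra.
by elim/big_rec2: _ => // i x y _ <-; rewrite El.
Qed.

Lemma real_bilinear_sumr (E : 'rV[R[i]]_g -> 'rV[R[i]]_g -> R)
    n (r : 'I_n -> R) (a : 'I_n -> 'rV[R[i]]_g) w :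
  is_real_bilinear E ->
  E w (\sum_j (r j)%:C *: a j) = \sum_j r j * E w (a j).
Proof.
by move=> [El Er]; apply: (@real_bilinear_suml (fun u v => E v u)); split.
Qed.

(** The images of a Q-basis of [K] span [C^g] over the reals, and the values on them are
    prescribed. *)
Lemma E_form_unique E E' : is_E_form phi xi E -> is_E_form phi xi E' -> E = E'.
Proof.
move=> [bE hE] [bE' hE']; apply/funext => u; apply/funext => v.
have [r ->] := CM_vec_span u; have [t ->] := CM_vec_span v.
rewrite !real_bilinear_suml //; apply: eq_bigr => j _; congr (_ * _).
rewrite !real_bilinear_sumr //; apply: eq_bigr => k _.
by rewrite hE hE'.
Qed.
End Enumerated.
End CMType.

(** * The self-dual lattice *)

Section DualLattice.
Variables (g : nat) (L : fieldExtType rat) (b bs : 'I_g -> L).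
Hypothesis dimL : g = \dim {:L}.
Hypothesis hbs : is_dual_basis b bs.

Lemma dual_basisC : is_dual_basis bs b.
Proof. by move=> i j; rewrite mulrC hbs eq_sym. Qed.

(** Pairing with [bs] shows that [b] is free, hence a basis by counting; pairing again reads off the
    coordinates. *)
Lemma dual_basis_expansion x : x = \sum_i field_trace (x * bs i) *: b i.
Proof.
have bE i : b i = [tuple b j | j < g]`_i by rewrite -tnth_nth tnth_mktuple.
have freeb : free [tuple b j | j < g].
  apply/freeP => q; under eq_bigr do rewrite -bE.
  move=> /(congr1 (fun y => field_trace (y * bs _))) q0 i; move: (q0 i) => /=.
  rewrite mul0r linear0 mulr_suml linear_sum (bigD1 i) //= big1.
    by rewrite addr0 -scalerAl linearZ /= hbs eqxx mulr1.
  by move=> j ji; rewrite -scalerAl linearZ /= hbs (negPf ji) mulr0.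
have basisb : basis_of {:L} [tuple b j | j < g].
  by rewrite basisEfree freeb subvf size_tuple /= dimL.
have xE : x = \sum_i coord [tuple b j | j < g] i x *: b i.
  rewrite {1}(coord_basis basisb (memvf x)); apply: eq_bigr => i _.
  by rewrite -bE.
rewrite {1}xE; apply: eq_bigr => i _; congr (_ *: _).
rewrite {2}xE mulr_suml linear_sum (bigD1 i) //= big1.
  by rewrite addr0 -scalerAl linearZ /= hbs eqxx mulr1.
by move=> j ji; rewrite -scalerAl linearZ /= hbs (negPf ji) mulr0.
Qed.

End DualLattice.

Section DualIdeal.
Variables (g : nat) (L : fieldExtType rat) (b bs : 'I_g -> L).
Hypothesis dimL : g = \dim {:L}.
Hypothesis hbs : is_dual_basis b bs.
Variables (fb : set L) (delta : L).
Hypothesis fb_submodule : is_integer_submodule fb.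
Hypothesis fb_basis : is_Zbasis fb b.
Hypothesis delta_neq0 : delta != 0.
Hypothesis deltaE : forall x, codifferent L x <-> ring_of_integers L (delta * x).

Lemma trace_Zcombination (n : 'I_g -> int) j :
  field_trace ((\sum_i b i *~ n i) * bs j) = (n j)%:~R.
Proof.
rewrite mulr_suml linear_sum (bigD1 j) //= big1 ?addr0.
  by rewrite mulrzAl raddfMz /= hbs eqxx.
by move=> i ij; rewrite mulrzAl raddfMz /= hbs (negPf ij) mul0rz.
Qed.

Lemma mem_fb x :
  fb x <-> forall j, field_trace (x * bs j) \is a Num.int.
Proof.
rewrite fb_basis.1; split=> [[n _ <-] j|h].
  by rewrite trace_Zcombination rpred_int.
have /choice[n nE] : forall j, exists n : int, field_trace (x * bs j) = n%:~R.
  by move=> j; apply/intrP.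
exists n => //; rewrite [RHS](dual_basis_expansion dimL hbs).
by apply: eq_bigr => i _; rewrite nE scaler_int.
Qed.

Lemma mem_basis i : fb (b i).
Proof. by apply/mem_fb => j; rewrite hbs; case: (i == j). Qed.

(** For [x] in [fb] and [y] integral, [x * y] is in [fb], so [Tr (bs_j x y)] is an integer. Thus
    [bs_j x] is in the codifferent, and [delta] times it is integral. *)
Lemma mem_inv_dual_basis j : ideal_inv fb (delta * bs j).
Proof.
move=> x fbx; rewrite -mulrA; apply/deltaE => y Oy.
rewrite -mulrA mulrC [x * y]mulrC; move: j; apply/mem_fb.
by have [_ _ hM] := fb_submodule; apply: hM.
Qed.

(** The coefficients are [Tr (delta^-1 y b_j)], the coordinates of [delta^-1 y] in [bs]; they are
    integers since [y * b_j] is integral and [delta^-1] carries it into the codifferent. *)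
Lemma inv_dual_basis y : ideal_inv fb y ->
  exists n : 'I_g -> int, y = \sum_i (delta * bs i) *~ n i.
Proof.
move=> hy; have /choice[n nE] : forall j, exists n : int,
    field_trace (delta^-1 * y * b j) = n%:~R.
  move=> j; apply/intrP; rewrite -[_ * b j]mulr1.
  have /deltaE : ring_of_integers L (delta * (delta^-1 * y * b j)).
    by rewrite -mulrA mulVKf //; apply: hy; exact: mem_basis.
  by apply; exact: integer1.
exists n; rewrite -[LHS](mulVKf delta_neq0).
rewrite [delta^-1 * y](dual_basis_expansion dimL (dual_basisC hbs)) mulr_sumr.
by apply: eq_bigr => i _; rewrite nE scaler_int mulrzAr.
Qed.

(** Replacing [x] by its integral multiples, which stay in [fb], upgrades the trace condition to
    membership of [delta^-1 w x] in the codifferent. *)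
Lemma inv_of_trace_int w :
  (forall x, fb x -> field_trace (delta^-1 * (w * x)) \is a Num.int) ->
  ideal_inv fb w.
Proof.
move=> h x fbx; rewrite -[w * x](mulVKf delta_neq0); apply/deltaE => y Oy.
rewrite -!mulrA; apply: h; rewrite mulrC.
by have [_ _ hM] := fb_submodule; apply: hM.
Qed.

Lemma mem_of_trace_int u :
  (forall y, ideal_inv fb y -> field_trace (delta^-1 * (u * y)) \is a Num.int) ->
  fb u.
Proof.
move=> h; apply/mem_fb => j; have := h _ (mem_inv_dual_basis j).
by rewrite mulrCA mulKf.
Qed.

Lemma trace_int_inv_mul x y : fb x -> ideal_inv fb y ->
  field_trace (delta^-1 * (x * y)) \is a Num.int.
Proof.
move=> fbx hy; rewrite -[_ * _]mulr1.
have /deltaE : ring_of_integers L (delta * (delta^-1 * (x * y))).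
  by rewrite mulVKf // mulrC; exact: hy.
by apply; exact: integer1.
Qed.
End DualIdeal.

Lemma CM_vec_Zcombination (R : realType) (g : nat) (K : fieldExtType rat)
    (phi : 'I_g -> {rmorphism K -> R[i]}) (I : finType) (F : I -> K)
    (n : I -> int) :
  CM_vec phi (\sum_k F k *~ n k) = \sum_k CM_vec phi (F k) *~ n k.
Proof.
apply/rowP => i; rewrite summxE mxE rmorph_sum; apply: eq_bigr => k _.
rewrite raddfMz /=; case: (n k) => m; first by rewrite -!pmulrn mulmxnE mxE.
by rewrite !NegzE !mulrNz -!pmulrn !mxE mulmxnE mxE.
Qed.

(** * The lattice [fa]: Z-basis, self-duality and inverse ideal *)

Section Lattice.
Variables (R : realType) (g : nat) (K : fieldExtType rat) (K0 : {subfield K}).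
Variable s : {rmorphism K -> K}.
Hypothesis sE : forall (phi : {rmorphism K -> R[i]}) x, phi (s x) = (phi x)^*.
Hypothesis K0E : forall x, (x \in K0) = (s x == x).
Hypothesis dimK0 : \dim K0 = g.
Hypothesis dimK : \dim {:K} = (2 * g)%N.
Variable delta : subvs_of K0.
Hypothesis delta_neq0 : delta != 0.
Hypothesis deltaE :
  forall x, codifferent (subvs_of K0) x <-> ring_of_integers _ (delta * x).
Variable fb : set (subvs_of K0).
Hypothesis fb_submodule : is_integer_submodule fb.
Variables b bs : 'I_g -> subvs_of K0.
Hypothesis fb_basis : is_Zbasis fb b.
Hypothesis hbs : is_dual_basis b bs.
Variable z : K.
Local Notation v := (vsval : subvs_of K0 -> K).
Local Notation fa := [set z * v x + v y | x in fb & y in ideal_inv fb].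
Hypothesis fa_submodule : is_integer_submodule fa.

Definition lattice_basis (k : 'I_g + 'I_g) : K :=
  match k with inl i => z * v (b i) | inr i => v (delta * bs i) end.

Let g_gt0 : (0 < g)%N.
Proof. by rewrite -dimK0 adim_gt0. Qed.

Let s_v (t : subvs_of K0) : s (v t) = v t.
Proof. by apply/eqP; rewrite -K0E subvsP. Qed.

Let sK : involutive s := s_involutive sE.

Let dim0 : g = \dim {:subvs_of K0} := dim_subvs_K0 dimK0.

Let fb0 : fb 0. Proof. by have [] := fb_submodule. Qed.
Let inv0 : ideal_inv fb 0. Proof. by have [] := ideal_inv_submodule fb. Qed.
Let mem_b i : fb (b i). Proof. exact: (mem_basis dim0 hbs fb_basis i). Qed.
Let mem_dbs i : ideal_inv fb (delta * bs i).
Proof. exact: (mem_inv_dual_basis dim0 hbs fb_submodule fb_basis deltaE). Qed.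

Lemma lattice_basis_mem k : fa (lattice_basis k).
Proof.
case: k => i /=.
  by exists (b i); [exact: mem_b|exists 0 => //; rewrite raddf0 addr0].
exists 0 => //; exists (delta * bs i); first exact: mem_dbs.
by rewrite raddf0 mulr0 add0r.
Qed.

Lemma lattice_basis_neq0 i : lattice_basis (inr i) != 0.
Proof.
apply/eqP => /= h; have : delta * bs i = 0 by apply: val_inj; rewrite /= h.
move/eqP; rewrite mulf_eq0 (negPf delta_neq0) /= => /eqP bs0.
by have /eqP := hbs i i; rewrite bs0 mulr0 linear0 eqxx eq_sym oner_eq0.
Qed.

(* Otherwise [fa] would be contained in [K0], but it is stable under O_K. *)
Lemma z_conj_neq : z - s z != 0.
Proof.
apply/eqP => /eqP; rewrite subr_eq0 eq_sym -K0E => zK0.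
have faK0 x : fa x -> x \in K0.
  by move=> [u _ [w _ <-]]; rewrite rpredD ?rpredM ?subvsP.
pose y := lattice_basis (inr (Ordinal g_gt0)).
suff : ({:K} <= K0)%VS.
  by move/dimvS; rewrite dimK dimK0 -[leqRHS]mul1n leq_pmul2r.
apply/subvP => x _; have [d d0 dx] := exists_integral_multiple x.
have [_ _ hM] := fa_submodule.
have : x *~ d * y \in K0 by apply/faK0/hM => //; exact: lattice_basis_mem.
have y0 : y != 0 := lattice_basis_neq0 _.
have yK0 : y \in K0 by exact: subvsP.
have dK : (d%:~R : K) != 0 by rewrite ext_intr_eq0.
move=> h; have -> : x = (x *~ d * y) / (y * d%:~R).
  by rewrite -[x *~ d]mulrzr -[x * _ * y]mulrA (mulrC _ y) mulfK // mulf_neq0.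
by rewrite rpred_div // rpredM // rpred_int.
Qed.

Lemma z_decomposition x : exists u w : subvs_of K0, x = z * v u + v w.
Proof.
have zs := z_conj_neq.
(* Solution of [x = z u + w] and [s x = s z u + w], the second being the conjugate of the first when
   [u] and [w] are in [K0]. *)
pose u := (x - s x) / (z - s z); pose w := x - z * u.
have su : s u = u.
  by rewrite /u fmorph_div !rmorphB !sK -[s x - x]opprB -[s z - z]opprB invrN mulrNN.
have uK : u \in K0 by rewrite K0E su.
have wK : w \in K0.
  rewrite K0E /w rmorphB rmorphM su -subr_eq0; apply/eqP.
  by rewrite /u; field.
by exists (Subvs uK), (Subvs wK); rewrite /= /w addrC subrK.
Qed.

Lemma z_independent (u w : subvs_of K0) : z * v u + v w = 0 -> u = 0 /\ w = 0.
Proof.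
move=> h0; have := congr1 s h0; rewrite rmorph0 rmorphD rmorphM !s_v => h1.
have : (z - s z) * v u = 0.
  by rewrite -[RHS](subrr (0 : K)) -{1}h0 -h1; ring.
move/eqP; rewrite mulf_eq0 (negPf z_conj_neq) /= => /eqP u0.
move: h0; rewrite u0 mulr0 add0r => w0.
by split; apply: val_inj; rewrite /= ?u0 ?w0.
Qed.

Definition lattice_xi : K := (z - s z)^-1 * (v delta)^-1.
Local Notation xi := lattice_xi.

Let vdelta_neq0 : v delta != 0.
Proof. by apply: contra_neq delta_neq0 => h; apply: val_inj; rewrite /= h. Qed.

Lemma lattice_xi_neq0 : xi != 0.
Proof. by rewrite mulf_neq0 ?invr_eq0 // z_conj_neq. Qed.

Lemma s_lattice_xi : s xi = - xi.
Proof. by rewrite rmorphM !fmorphV rmorphB sK s_v -[s z - z]opprB invrN mulNr. Qed.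

(** With [A] and [B] the two arguments, the terms in [z * s z] and those without [z] cancel in
    [A * s B - s A * B], leaving [(z - s z) (u w' - w u')]; the factor [z - s z] is the one that
    [xi] inverts. *)
Lemma lattice_trace (u w u' w' : subvs_of K0) :
  field_trace (xi * (z * v u + v w) * s (z * v u' + v w')) =
  field_trace (delta^-1 * (u * w' - w * u')).
Proof.
have [phi phi_bij] := Phi_enum sE dimK lattice_xi_neq0 s_lattice_xi.
apply: (field_trace_tower sE K0E dimK0 dimK lattice_xi_neq0 s_lattice_xi phi_bij).
set A := z * _ + _; set B := z * _ + _.
have -> : s (xi * A * s B) = - xi * s A * B by rewrite 2!(rmorphM s) sK s_lattice_xi.
rewrite /A /B !(rmorphD s) !(rmorphM s z) /= !s_v.
by rewrite /lattice_xi; field; rewrite z_conj_neq vdelta_neq0.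
Qed.

Lemma lattice_trace_int x y : fa x -> fa y ->
  field_trace (xi * x * s y) \is a Num.int.
Proof.
move=> [u fu [w hw <-]] [u' fu' [w' hw' <-]]; rewrite lattice_trace.
have tr := trace_int_inv_mul delta_neq0 deltaE.
rewrite mulrBr linearB /= [w * u']mulrC.
by apply: rpredB; [exact: (tr fb)|exact: (tr fb)].
Qed.

(** Pairing with [w'] in [fb^-1] isolates the coordinate [u] of [x], and pairing with [z u'] for
    [u'] in [fb] isolates [w]. *)
Lemma lattice_self_dual x :
  (forall y, fa y -> field_trace (xi * x * s y) \is a Num.int) -> fa x.
Proof.
have [u [w ->]] := z_decomposition x => h.
exists u.
  apply: (mem_of_trace_int dim0 hbs fb_submodule fb_basis delta_neq0 deltaE).
  move=> w' hw'; have := h (z * v 0 + v w'); rewrite lattice_trace (mulr0 w) subr0.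
  by apply; exists 0 => //; exists w'.
exists w => //.
apply: (inv_of_trace_int fb_submodule delta_neq0 deltaE) => u' fu'.
have := h (z * v u' + v 0); rewrite lattice_trace (mulr0 u) sub0r mulrN linearN rpredN.
by apply; exists u' => //; exists 0.
Qed.

Lemma lattice_Zcombination (n : 'I_g + 'I_g -> int) :
  \sum_k lattice_basis k *~ n k =
  z * v (\sum_i b i *~ n (inl i)) + v (\sum_i (delta * bs i) *~ n (inr i)).
Proof.
rewrite big_sumType /=; congr (_ + _).
  rewrite raddf_sum mulr_sumr; apply: eq_bigr => i _.
  by rewrite raddfMz mulrzAr.
by rewrite raddf_sum; apply: eq_bigr => i _; rewrite raddfMz.
Qed.

Lemma lattice_Zbasis : is_Zbasis fa lattice_basis.
Proof.
split; last first.
  move=> n; rewrite lattice_Zcombination => /z_independent[h1 h2] [] i.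
    exact: (fb_basis.2 _ h1).
  (* The [delta bs_j] are independent: divide the relation by [delta] and pair it with [b i]. *)
  have : field_trace ((\sum_j bs j *~ n (inr j)) * b i) = 0.
    rewrite [X in X * _](_ : _ = 0) ?mul0r ?linear0 //.
    apply: (mulfI delta_neq0); rewrite mulr0 -[RHS]h2 mulr_sumr.
    by apply: eq_bigr => j _; rewrite mulrzAr.
  rewrite (trace_Zcombination (dual_basisC hbs) (fun j => n (inr j))).
  by move/eqP; rewrite intr_eq0 => /eqP.
apply/seteqP; split => [_ [u + [w + <-]]|_ [n _ <-]].
  rewrite {1}fb_basis.1 => -[n1 _ <-].
  move=> /(inv_dual_basis dim0 hbs fb_basis delta_neq0 deltaE)[n2 ->].
  exists (fun k => match k with inl i => n1 i | inr i => n2 i end) => //.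
  by rewrite lattice_Zcombination.
apply: submodule_sum fa_submodule _ => k _.
exact: submoduleMz fa_submodule (lattice_basis_mem k).
Qed.

Lemma lattice_fractional : is_fractional_ideal fa.
Proof.
split => //.
  exists (lattice_basis (inr (Ordinal g_gt0))); first exact: lattice_basis_mem.
  exact: lattice_basis_neq0.
have [d d0 hd] := common_integral_multiple lattice_basis.
exists d%:~R; first by split; [exact: integer_int|rewrite ext_intr_eq0].
move=> x; rewrite lattice_Zbasis.1 => -[n _ <-]; rewrite mulr_sumr.
apply: submodule_sum (@integer_submodule K) _ => k _.
by rewrite mulrzAr mulrzl; exact: submoduleMz (@integer_submodule K) (hd k).
Qed.

Lemma lattice_inverse_ideal :
  principal_ideal xi =
  ideal_inv (ideal_mul (ideal_mul fa [set s x | x in fa]) (different K)).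
Proof.
have OK := @integer_submodule K.
apply/seteqP; split=> [_ [o Oo <-] _ [n [u' [d [hd ->]]]]|x hx].
  rewrite mulr_sumr; apply: submodule_sum (OK) _ => i _.
  have [[m [a [a' [ha ->]]]] dD] := hd i.
  rewrite mulrCA mulr_suml.
  apply: submodule_sum (OK) _ => j _; have [fa_a [c fa_c <-]] := ha j.
  (* Regrouped so that [d i], in the different, multiplies an element of the codifferent; the test
     factor [y] is then absorbed into [a j], since [fa] is stable under integers. *)
  have -> : a j * s c * (xi * o * d i) = o * (d i * (xi * a j * s c)) by ring.
  apply: integerM => //; apply: dD => y Oy.
  have -> : xi * a j * s c * y = xi * (y * a j) * s c by ring.
  apply: lattice_trace_int => //.
  by have [_ _ hM] := fa_submodule; apply: hM.
have xi0 := lattice_xi_neq0.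
have stable a : fa a -> fa (x / xi * a).
  move=> fa_a; apply: lattice_self_dual => c fa_c.
  have -> : xi * (x / xi * a) * s c = x * (a * s c) by field.
  rewrite -[x * _]mulr1.
  suff : codifferent K (x * (a * s c)) by apply; exact: integer1.
  apply: codifferent_reflexive => d dD; rewrite -mulrA; apply: hx.
  exists 1%N, (fun=> a * s c), (fun=> d); split; last by rewrite big_ord1.
  move=> _; split => //.
  exists 1%N, (fun=> a), (fun=> s c); split; last by rewrite big_ord1.
  by move=> _; split => //; exists c.
exists (x / xi); last by rewrite mulrC divfK.
have /choice[N NE] : forall k, exists n : 'I_g + 'I_g -> int,
    x / xi * lattice_basis k = \sum_j lattice_basis j *~ n j.
  move=> k; have := stable _ (lattice_basis_mem k).
  by rewrite {1}lattice_Zbasis.1 => -[n _ <-]; exists n.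
apply: (integral_of_stable_family (e := lattice_basis) (N := N)) => //.
by exists (inr (Ordinal g_gt0)); exact: lattice_basis_neq0.
Qed.
End Lattice.

Theorem theorem7p4 (R : realType) (g : nat) (K : fieldExtType rat)
    (K0 : {subfield K})
    (hK : is_CM_field R K) (hdeg : \dim {:K} = (2 * g)%N)
    (hK0 : is_maximal_totally_real R K0)
    (delta : subvs_of K0)
    (hdelta : different (subvs_of K0) = principal_ideal delta)
    (fb : set (subvs_of K0)) (hfb : is_fractional_ideal fb)
    (b : 'I_g -> subvs_of K0) (hb : is_Zbasis fb b)
    (bs : 'I_g -> subvs_of K0) (hbs : is_dual_basis b bs)
    (z : K) (fa : set K)
    (hfa : fa = [set z * vsval x + vsval y | x in fb & y in ideal_inv fb])
    (hfaO : is_integer_submodule fa)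
    (xi : K) (hxi : xi = (z - cm_conj R z)^-1 * (vsval delta)^-1)
    (Phi : set {rmorphism K -> R[i]})
    (hPhi : Phi =
       [set phi : {rmorphism K -> R[i]} | 0 < complex.Im (phi xi)]) :
  [/\ is_CM_type g Phi,
      is_fractional_ideal fa,
      principal_ideal xi =
        ideal_inv
          (ideal_mul (ideal_mul fa [set cm_conj R x | x in fa]) (different K)),
      forall phi, Phi phi ->
        complex.Re (phi xi) = 0 /\ 0 < complex.Im (phi xi)
    & forall phi : 'I_g -> {rmorphism K -> R[i]},
        set_bij [set: 'I_g] Phi phi ->
        let e := fun i => CM_vec phi (z * vsval (b i)) in
        let v := fun i => CM_vec phi (vsval (delta * bs i)) in
        [/\ is_Zbasis (CM_vec phi @` fa)
              (fun k : 'I_g + 'I_g =>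
                 match k with inl i => e i | inr i => v i end),
            exists! E : 'rV[R[i]]_g -> 'rV[R[i]]_g -> R, is_E_form phi xi E
          & forall E : 'rV[R[i]]_g -> 'rV[R[i]]_g -> R,
              is_E_form phi xi E -> is_symplectic_basis E e v]].
Proof.
have [s [cmE sE K0E dimK0E]] := cm_conj_rmorphism hK hK0.
have dimK0 : \dim K0 = g.
  by move: dimK0E; rewrite hdeg => /eqP; rewrite eqn_pmul2l // => /eqP.
have [delta0 deltaE] := codifferent_of_principal_different hdelta.
have fbO : is_integer_submodule fb by have [] := hfb.
subst fa Phi; rewrite cmE in hxi *.
have xiE : xi = lattice_xi s delta z by [].
have xi0 : xi != 0.
  by rewrite xiE (lattice_xi_neq0 K0E dimK0 hdeg delta0 deltaE fbO hb hbs hfaO).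
have sxi : s xi = - xi by rewrite xiE (s_lattice_xi sE K0E).
have trE := lattice_trace sE K0E dimK0 hdeg delta0 deltaE fbO hb hbs hfaO.
have basisE := lattice_Zbasis K0E dimK0 hdeg delta0 deltaE fbO hb hbs hfaO.
split.
- exact: (Phi_CM_type sE hdeg xi0 sxi).
- exact: (lattice_fractional K0E dimK0 hdeg delta0 deltaE fbO hb hbs hfaO).
- rewrite xiE.
  exact: (lattice_inverse_ideal sE K0E dimK0 hdeg delta0 deltaE fbO hb hbs hfaO).
- by move=> phi Phi_phi; split => //; exact: (Re_xi sE sxi phi).
move=> phi phi_bij e v.
have g0 : (0 < g)%N by rewrite -dimK0 adim_gt0.
have vecE k : (match k with inl i => e i | inr i => v i end) =
    CM_vec phi (lattice_basis delta b bs z k) by case: k.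
split.
- split.
    rewrite basisE.1; apply/seteqP; split=> [_ [_ [n _ <-] <-]|_ [n _ <-]].
      exists n => //; rewrite CM_vec_Zcombination.
      by apply: eq_bigr => k _; rewrite vecE.
    exists (\sum_k lattice_basis delta b bs z k *~ n k); first by exists n.
    by rewrite CM_vec_Zcombination; apply: eq_bigr => k _; rewrite vecE.
  move=> n; under eq_bigr do rewrite vecE.
  rewrite -CM_vec_Zcombination => h; apply: basisE.2.
  apply: (CM_vec_inj (phi := phi) g0); rewrite h.
  by apply/rowP => i; rewrite !mxE rmorph0.
- have formE := CM_form_E sE hdeg xi0 sxi phi_bij cmE.
  exists (CM_form xi phi); split=> // E hE.
  exact: (E_form_unique sE hdeg xi0 sxi phi_bij formE hE).
move=> E [_ hE].
have v0 : vsval (0 : subvs_of K0) = 0 by exact: raddf0.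
(* All the symplectic relations are read off this formula, each basis vector having [u = 0] or
   [w = 0]; the factor [delta] of [delta * bs j] cancels [delta^-1]. *)
have Eq (u w u' w' : subvs_of K0) :
    E (CM_vec phi (z * vsval u + vsval w)) (CM_vec phi (z * vsval u' + vsval w')) =
    ratr (field_trace (delta^-1 * (u * w' - w * u'))).
  by rewrite hE cmE xiE trE.
have eE i : e i = CM_vec phi (z * vsval (b i) + vsval (0 : subvs_of K0)).
  by rewrite v0 addr0.
have vE i : v i = CM_vec phi (z * vsval (0 : subvs_of K0) + vsval (delta * bs i)).
  by rewrite v0 mulr0 add0r.
split=> i j.
- rewrite eE vE Eq mul0r subr0 mulrCA mulKf // hbs.
  by rewrite rmorph_nat.
- by rewrite !eE Eq mulr0 mul0r subrr mulr0 linear0 rmorph0.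
- by rewrite !vE Eq mulr0 mul0r subrr mulr0 linear0 rmorph0.
Qed.
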